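(* Let $G$ be a mixed unit interval graph with $n$ vertices and $m$ edges, and let $\mathcal{B}$ be a $\mathcal{U}$-bubble model for $G$. Then $\mathrm{cwd}(G)\le\varphi_{\mathcal{B}}(G)+2$. Moreover, a $(\varphi_{\mathcal{B}}(G)+2)$-expression defining $G$ can be constructed in $O(n+m)$ time provided $\mathcal{B}$ is given.
   Context: Clique-width: $\mathrm{cwd}(G)$ is the smallest $k$ such that $G$ can be constructed using at most $k$ labels by the operations: creating a single vertex with label $i$; disjoint union; relabeling all labels $i$ to $j$; and, for $i\ne j$, adding all edges between vertices labelled $i$ and vertices labelled $j$. Such a term using at most $k$ labels is a $k$-expression. A mixed unit interval graph is an intersection graph of unit intervals, each closed, open or half-open. A 2-dimensional $\mathcal{U}$-bubble structure for a finite nonempty set $A$ is a family $\mathcal{B}=\langle B_{i,j}\rangle_{1\le j\le k,\,1\le i\le r_j}$ of pairwise disjoint (possibly empty) sets (''bubbles'') with union $A$, each partitioned into quadrants $B_{i,j}=B^{++}_{i,j}\cup B^{+-}_{i,j}\cup B^{-+}_{i,j}\cup B^{--}_{i,j}$; $B^{*+}_{i,j}=B^{++}_{i,j}\cup B^{-+}_{i,j}$, $B^{+*}_{i,j}=B^{++}_{i,j}\cup B^{+-}_{i,j}$. Column $j$ consists of the bubbles with second index $j$; row $i$ of those with first index $i$. The graph $G(\mathcal{B})$ has vertex set $A$, and distinct $u,v$ are adjacent iff, for some ordering, $u\in B_{i,j}$, $v\in B_{i',j'}$ and: (a) $j=j'$; or (b) $j=j'-1$ and $i>i'$; or (c) $j=j'-1$,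 $i=i'$, $u\in B^{*+}_{i,j}$, $v\in B^{+*}_{i',j'}$. A $\mathcal{U}$-bubble model of $G$ is such a structure for $V(G)$ with $G\cong G(\mathcal{B})$, every row and column containing a nonempty bubble, $B_{r_j,j}\ne\emptyset$ for all $j$, and with $\mathrm{top}(j)=\min\{i:B_{i,j}\ne\emptyset\}$, $\mathrm{top}(1)=1$, $\mathrm{top}(j)\le \mathrm{top}(j+1)$. Groups: vertices of the same column $j$ belong to the same group if they have the same neighbours in column $j+1$. For $v\in B_{i,j}$, the group number $g_{\mathcal{B}}(v)$ is the maximum, over the two choices $A=B^{*+}_{i,j-1}\cup B^{+*}_{i,j}$ and $A=B_{i,j}$, of the number of groups in $N(v)\cap\bigl(\bigcup_{i'=i+1}^{r_{j-1}}B_{i',j-1}\cup\bigcup_{i'=1}^{i-1}B_{i',j}\cup A\bigr)$ (bubbles of a nonexistent column $0$ are empty). The group number of $G$ in $\mathcal{B}$ is $\varphi_{\mathcal{B}}(G)=\max_{v\in V(G)}g_{\mathcal{B}}(v)$. *)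

(* Defs.v *)
From mathcomp Require Import all_boot all_order all_algebra.
From mathcomp Require Import boolp reals.

Set Implicit Arguments.
Unset Strict Implicit.
Unset Printing Implicit Defensive.

Record sgraph (T : finType) := SGraph {
  adj :> rel T;
  adj_sym : symmetric adj;
  adj_irr : irreflexive adj }.

Definition nbh (T : finType) (G : sgraph T) (v : T) : {set T} := [set u | G v u].

Definition edges (T : finType) (G : sgraph T) : {set {set T}} :=
  [set e | [exists x, exists y, G x y && (e == [set x; y])]].

Definition rel_iso (T U : Type) (g : rel T) (h : rel U) : Prop :=
  exists2 f : T -> U, bijective f & forall x y, h (f x) (f y) = g x y.

(* [BSide true x] is a closed left bound and an open right bound, so the four
   values of [(l, r)] give the open, closed and half-open intervals. *)
Definition unit_interval (R : realType) (x : R) (l r : bool) : interval R :=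
  Interval (BSide l x) (BSide r (x + 1)%R).

Definition mixed_unit_interval (R : realType) (T : finType) (G : sgraph T) : Prop :=
  exists I : T -> interval R,
    (forall v, exists x l r, I v = unit_interval x l r) /\
    (forall u v, u != v -> (G u v <-> exists z : R, z \in I u /\ z \in I v)).

Inductive cwexpr :=
  | CVertex of nat
  | CUnion of cwexpr & cwexpr
  | CRelabel of nat & nat & cwexpr
  | CJoin of nat & nat & cwexpr.

Fixpoint cw_vertex (e : cwexpr) : finType :=
  match e with
  | CVertex _ => unit
  | CUnion e1 e2 => (cw_vertex e1 + cw_vertex e2)%type
  | CRelabel _ _ e1 => cw_vertex e1
  | CJoin _ _ e1 => cw_vertex e1
  end.

Fixpoint cw_label (e : cwexpr) : cw_vertex e -> nat :=
  match e return cw_vertex e -> nat with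
  | CVertex i => fun _ => i
  | CUnion e1 e2 => fun x =>
      match x with inl x1 => @cw_label e1 x1 | inr x2 => @cw_label e2 x2 end
  | CRelabel i j e1 => fun x => if @cw_label e1 x == i then j else @cw_label e1 x
  | CJoin _ _ e1 => fun x => @cw_label e1 x
  end.

Fixpoint cw_adj (e : cwexpr) : rel (cw_vertex e) :=
  match e return rel (cw_vertex e) with
  | CVertex _ => fun _ _ => false
  | CUnion e1 e2 => fun x y =>
      match x, y with
      | inl x1, inl y1 => @cw_adj e1 x1 y1
      | inr x2, inr y2 => @cw_adj e2 x2 y2
      | _, _ => false
      end
  | CRelabel _ _ e1 => fun x y => @cw_adj e1 x y
  | CJoin i j e1 => fun x y =>
      [|| @cw_adj e1 x y, (@cw_label e1 x == i) && (@cw_label e1 y == j)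
        | (@cw_label e1 x == j) && (@cw_label e1 y == i)]
  end.

Fixpoint cw_wf (e : cwexpr) : bool :=
  match e with
  | CVertex _ => true
  | CUnion e1 e2 => cw_wf e1 && cw_wf e2
  | CRelabel _ _ e1 => cw_wf e1
  | CJoin i j e1 => (i != j) && cw_wf e1
  end.

Fixpoint cw_labels (e : cwexpr) : seq nat :=
  match e with
  | CVertex i => [:: i]
  | CUnion e1 e2 => cw_labels e1 ++ cw_labels e2
  | CRelabel i j e1 => [:: i, j & cw_labels e1]
  | CJoin i j e1 => [:: i, j & cw_labels e1]
  end.

Definition k_expression (k : nat) (e : cwexpr) : Prop :=
  cw_wf e /\ size (undup (cw_labels e)) <= k.

Definition defines (e : cwexpr) (T : finType) (G : sgraph T) : Prop :=
  rel_iso G (@cw_adj e).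

Definition constructible (T : finType) (G : sgraph T) (k : nat) : Prop :=
  exists2 e, k_expression k e & defines e G.

(* [is_cwd G k]: k = cwd(G). *)
Definition is_cwd (T : finType) (G : sgraph T) (k : nat) : Prop :=
  constructible G k /\ forall k', constructible G k' -> k <= k'.

(* Columns and rows are numbered from 1.  [quadrant s t i j] is B^{st}_{i,j},
   with [true] for + and [false] for -; it is empty outside the index range. *)
Record ububble (T : finType) := UBubble {
  ncol : nat;
  nrow : nat -> nat;
  quadrant : bool -> bool -> nat -> nat -> {set T};
  quadrant_range : forall s t i j, quadrant s t i j != set0 ->
    (1 <= j <= ncol) && (1 <= i <= nrow j);
  quadrant_disjoint : forall s t i j s' t' i' j' x,
    x \in quadrant s t i j -> x \in quadrant s' t' i' j' ->
    (s, t, i, j) = (s', t', i', j');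
  quadrant_cover : forall x, exists s t i j, x \in quadrant s t i j;
  ububble_nonempty : 0 < #|T| }.

Section Bubbles.
Variables (T : finType) (B : ububble T).
Implicit Types (u v : T) (i j : nat) (S : {set T}).

Definition bubble_plus_any i j := quadrant B true true i j :|: quadrant B true false i j.
Definition bubble_any_plus i j := quadrant B true true i j :|: quadrant B false true i j.
Definition bubble i j :=
  quadrant B true true i j :|: quadrant B true false i j
  :|: quadrant B false true i j :|: quadrant B false false i j.

Definition column j : {set T} := \bigcup_(1 <= i < (nrow B j).+1) bubble i j.

Definition bubble_arc u v : Prop :=
  exists i j i' j', [/\ u \in bubble i j, v \in bubble i' j' &
    [\/ j = j',
        j.+1 = j' /\ i' < i
      | [/\ j.+1 = j', i = i', u \in bubble_any_plus i j
          & v \in bubble_plus_any i' j']]].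

Definition bubble_adj : rel T :=
  fun u v => (u != v) && `[< bubble_arc u v \/ bubble_arc v u >].

Lemma bubble_adj_sym : symmetric bubble_adj.
Proof.
by move=> u v; rewrite /bubble_adj eq_sym; congr (_ && asbool _);
  apply/propext; split=> -[]; [right|left|right|left].
Qed.

Lemma bubble_adj_irr : irreflexive bubble_adj.
Proof. by move=> u; rewrite /bubble_adj eqxx. Qed.

Definition bubble_graph : sgraph T := SGraph bubble_adj_sym bubble_adj_irr.

Definition top j : nat := head 0 [seq i <- iota 1 (nrow B j) | bubble i j != set0].

Record ububble_model (G : sgraph T) : Prop := UBubbleModel {
  model_iso : rel_iso G bubble_graph;
  model_column : forall j, 1 <= j <= ncol B ->
    exists2 i, 1 <= i <= nrow B j & bubble i j != set0;
  model_row : forall i j, 1 <= j <= ncol B -> 1 <= i <= nrow B j ->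
    exists2 j', 1 <= j' <= ncol B & bubble i j' != set0;
  model_bottom : forall j, 1 <= j <= ncol B -> bubble (nrow B j) j != set0;
  model_top1 : top 1 = 1;
  model_top : forall j, 1 <= j < ncol B -> top j <= top j.+1 }.

(* [\max] only extracts the unique column, resp. row, containing v. *)
Definition col_of v : nat := \max_(j < (ncol B).+1 | v \in column j) j.
Definition row_of v : nat :=
  \max_(i < (nrow B (col_of v)).+1 | v \in bubble i (col_of v)) i.

Lemma bubbleP i j v :
  reflect (exists s t, v \in quadrant B s t i j) (v \in bubble i j).
Proof.
rewrite /bubble !inE; apply: (iffP idP) => [|[[] [[] ->]]]; rewrite ?orbT //.
by case/orP => [/orP[/orP[]|]|] h; [exists true, true|exists true, false
  |exists false, true|exists false, false].
Qed.

Lemma bubble_range i j v :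
  v \in bubble i j -> (1 <= j <= ncol B) && (1 <= i <= nrow B j).
Proof.
by case/bubbleP=> s [t h]; apply: (@quadrant_range _ B s t); apply/set0Pn; exists v.
Qed.

Lemma bubble_inj i j i' j' v :
  v \in bubble i j -> v \in bubble i' j' -> i = i' /\ j = j'.
Proof.
by move=> /bubbleP[s [t h]] /bubbleP[s' [t' h']]; case: (quadrant_disjoint h h').
Qed.

Lemma in_column j v : reflect (exists i, v \in bubble i j) (v \in column j).
Proof.
rewrite /column; apply: (iffP idP) => [|[i h]].
  elim/big_ind: _ => [|x y hx hy|i _ h]; last by exists i.
  - by rewrite inE.
  - by rewrite inE => /orP[/hx|/hy].
have /andP[_ ri] := bubble_range h.
by rewrite (big_rem i) ?mem_index_iota ?ltnS //= inE h.
Qed.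

Lemma col_ofE i j v : v \in bubble i j -> col_of v = j.
Proof.
move=> h; have /andP[/andP[_ hj] _] := bubble_range h.
apply/eqP; rewrite eqn_leq; apply/andP; split.
  by apply/bigmax_leqP => j' /in_column[i' h']; have [_ ->] := bubble_inj h h'.
rewrite /col_of (bigD1 (Ordinal (hj : j < (ncol B).+1))) ?leq_maxl //.
by apply/in_column; exists i.
Qed.

Lemma row_ofE i j v : v \in bubble i j -> row_of v = i.
Proof.
move=> h; have /andP[_ /andP[_ hi]] := bubble_range h.
rewrite /row_of (col_ofE h); apply/eqP; rewrite eqn_leq; apply/andP; split.
  by apply/bigmax_leqP => i' h'; have [-> _] := bubble_inj h h'.
by rewrite (bigD1 (Ordinal (hi : i < (nrow B j).+1))) ?leq_maxl.
Qed.

Definition same_group u v : bool :=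
  [exists j : 'I_(ncol B).+1,
    [&& u \in column j, v \in column j
      & nbh bubble_graph u :&: column j.+1 == nbh bubble_graph v :&: column j.+1]].

Definition group_of v : {set T} := [set u | same_group v u].

Definition num_groups S : nat := #|[set group_of v | v in S]|.

Definition group_number v : nat :=
  let i := row_of v in
  let j := col_of v in
  let D := (\bigcup_(i.+1 <= i' < (nrow B j.-1).+1) bubble i' j.-1)
           :|: (\bigcup_(1 <= i' < i) bubble i' j) in
  maxn (num_groups (nbh bubble_graph v
                    :&: (D :|: (bubble_any_plus i j.-1 :|: bubble_plus_any i j))))
       (num_groups (nbh bubble_graph v :&: (D :|: bubble i j))).

Definition phi : nat := \max_(v : T) group_number v.

End Bubbles.

(* A program uses finitely many registers and arrays.  Every value read or
   computed must be at most W, otherwise execution is stuck. *)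
Inductive rexpr :=
  | RCst of nat
  | RReg of nat
  | RGet of nat & rexpr
  | RAdd of rexpr & rexpr
  | RSub of rexpr & rexpr.

Inductive rcmd :=
  | RSkip
  | RSet of nat & rexpr
  | RPut of nat & rexpr & rexpr
  | REmit of rexpr
  | RSeq of rcmd & rcmd
  | RIf of rexpr & rcmd & rcmd
  | RWhile of rexpr & rcmd.

Record rstate := RState {
  regs : nat -> nat;
  arrs : nat -> nat -> nat;
  output : seq nat }.

Definition upd (A : Type) (f : nat -> A) (x : nat) (a : A) : nat -> A :=
  fun y => if y == x then a else f y.

Definition word (W v : nat) : option nat := if v <= W then Some v else None.

Fixpoint reval (W : nat) (s : rstate) (e : rexpr) : option nat :=
  match e with
  | RCst c => word W c
  | RReg x => word W (regs s x)
  | RGet a e1 => obind (fun i => word W (arrs s a i)) (reval W s e1)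
  | RAdd e1 e2 =>
      obind (fun x => obind (fun y => word W (x + y)) (reval W s e2)) (reval W s e1)
  | RSub e1 e2 =>
      obind (fun x => obind (fun y => word W (x - y)) (reval W s e2)) (reval W s e1)
  end.

Fixpoint rcost (e : rexpr) : nat :=
  match e with
  | RCst _ => 1
  | RReg _ => 1
  | RGet _ e1 => (rcost e1).+1
  | RAdd e1 e2 => (rcost e1 + rcost e2).+1
  | RSub e1 e2 => (rcost e1 + rcost e2).+1
  end.

(* [exec W c s t s']: with words bounded by W, c started in s halts in s' after
   t elementary steps.  A test succeeds when its value is nonzero. *)
Inductive exec (W : nat) : rcmd -> rstate -> nat -> rstate -> Prop :=
  | ExSkip s : exec W RSkip s 1 s
  | ExSet s x e v : reval W s e = Some v ->
      exec W (RSet x e) s (rcost e).+1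
        (RState (upd (regs s) x v) (arrs s) (output s))
  | ExPut s a e1 e2 i v : reval W s e1 = Some i -> reval W s e2 = Some v ->
      exec W (RPut a e1 e2) s (rcost e1 + rcost e2).+1
        (RState (regs s) (upd (arrs s) a (upd (arrs s a) i v)) (output s))
  | ExEmit s e v : reval W s e = Some v ->
      exec W (REmit e) s (rcost e).+1
        (RState (regs s) (arrs s) (rcons (output s) v))
  | ExSeq c1 c2 s t1 s1 t2 s2 :
      exec W c1 s t1 s1 -> exec W c2 s1 t2 s2 ->
      exec W (RSeq c1 c2) s (t1 + t2) s2
  | ExIf e c1 c2 s v t s1 : reval W s e = Some v ->
      exec W (if v != 0 then c1 else c2) s t s1 ->
      exec W (RIf e c1 c2) s ((rcost e).+1 + t) s1
  | ExWhileStop e c s : reval W s e = Some 0 ->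
      exec W (RWhile e c) s (rcost e).+1 s
  | ExWhileStep e c s v t1 s1 t2 s2 : reval W s e = Some v -> v != 0 ->
      exec W c s t1 s1 -> exec W (RWhile e c) s1 t2 s2 ->
      exec W (RWhile e c) s ((rcost e).+1 + t1 + t2) s2.

(* Input format.  Registers 0 and 1 hold the numbers of vertices and columns;
   arrays 0-3 hold, for each vertex, its column, its row, and whether it lies in
   a B^{+*}, resp. B^{*+}; array 4 holds r_j at index j.  All else is 0. *)
Definition ububble_input (T : finType) (B : ububble T) : rstate :=
  let in_plus_any v := v \in bubble_plus_any B (row_of B v) (col_of B v) in
  let in_any_plus v := v \in bubble_any_plus B (row_of B v) (col_of B v) in
  RState (nth 0 [:: #|T|; ncol B])
    (fun a => nth 0 (nth [::]
      [:: [seq col_of B v | v <- enum T];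
          [seq row_of B v | v <- enum T];
          [seq nat_of_bool (in_plus_any v) | v <- enum T];
          [seq nat_of_bool (in_any_plus v) | v <- enum T];
          0 :: [seq nrow B j | j <- iota 1 (ncol B)]] a))
    [::].

(* Output format: the expression in postfix notation. *)
Fixpoint cw_encode (e : cwexpr) : seq nat :=
  match e with
  | CVertex i => [:: 0; i]
  | CUnion e1 e2 => cw_encode e1 ++ cw_encode e2 ++ [:: 1]
  | CRelabel i j e1 => cw_encode e1 ++ [:: 2; i; j]
  | CJoin i j e1 => cw_encode e1 ++ [:: 3; i; j]
  end.

(* Main.v *)
Require Import Defs.
From mathcomp Require Import all_boot all_order all_algebra.
From mathcomp Require Import boolp reals.
From mathcomp Require Import zify.

(** Order the vertices by column, then row, then B^{+*} before B^{-*} within a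
    bubble, and number the positions from 0.  The neighbours of [u] that come after [u]
    are the rest of its column followed by an initial segment of the next column,
    so they occupy exactly the positions between that of [u] and an end [E u].
    Hence two earlier vertices with the same end can share a label from now on,
    and a vertex whose end has been passed can receive the dead label 0.  When [v]
    is inserted, the distinct ends lying beyond [v] come from neighbours of [v] in
    distinct groups, so there are at most [group_number v] of them; together with
    the dead label and the label of [v] this gives [phi + 2] labels.

    The running time is governed by the sum over the columns [c] of
    |c| (|c| + |c+1|): since columns are cliques, this is O(n + m), which pays for
    sorting every column by counting, for comparing it with the next column, and
    for scanning all possible ends when a vertex is inserted. *)

Set Implicit Arguments.
Unset Strict Implicit.
Unset Printing Implicit Defensive.

(** * Programs with a time bound *)

Arguments upd {A} f x a y /.

(** Separating the value from the word bounds, which go to [fits], lets values be obtained by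
    simplification and leaves the bounds as linear arithmetic. *)
Fixpoint ev (s : rstate) (e : rexpr) : nat :=
  match e with
  | RCst c => c
  | RReg x => regs s x
  | RGet a e1 => arrs s a (ev s e1)
  | RAdd e1 e2 => ev s e1 + ev s e2
  | RSub e1 e2 => ev s e1 - ev s e2
  end.

Fixpoint fits (W : nat) (s : rstate) (e : rexpr) : bool :=
  match e with
  | RCst c => c <= W
  | RReg x => regs s x <= W
  | RGet a e1 => fits W s e1 && (arrs s a (ev s e1) <= W)
  | RAdd e1 e2 => [&& fits W s e1, fits W s e2 & ev s e1 + ev s e2 <= W]
  | RSub e1 e2 => fits W s e1 && fits W s e2
  end.

Lemma fits_ev W s e : fits W s e -> ev s e <= W.
Proof.
elim: e => //= [a e _ /andP[]|e1 _ e2 _ /and3P[]|e1 IH1 e2 _ /andP[/IH1 h _]] //.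
exact: leq_trans (leq_subr _ _) h.
Qed.

Lemma revalE W s e : fits W s e -> reval W s e = Some (ev s e).
Proof.
elim: e => /= [c|x|a e IH|e1 IH1 e2 IH2|e1 IH1 e2 IH2]; rewrite /word.
- by move->.
- by move->.
- by case/andP=> /IH-> /= ->.
- by case/and3P=> /IH1-> /IH2-> /= ->.
case/andP=> h1 h2; rewrite IH1 // IH2 //= (leq_trans (leq_subr _ _)) //.
exact: fits_ev.
Qed.

(** * Weakest preconditions that track the step count *)

Definition wp (W : nat) (c : rcmd) (s : rstate) (Q : nat -> rstate -> Prop) : Prop :=
  exists t s', exec W c s t s' /\ Q t s'.

Section WP.
Variable W : nat.
Implicit Types (s : rstate) (Q : nat -> rstate -> Prop).

Lemma wp_conseq c s Q Q' :
  wp W c s Q -> (forall t s', Q t s' -> Q' t s') -> wp W c s Q'.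
Proof. by move=> [t [s' [h q]]] h'; exists t, s'; split=> //; apply: h'. Qed.

Lemma wp_skip s Q : Q 1 s -> wp W RSkip s Q.
Proof. by move=> q; exists 1, s; split=> //; constructor. Qed.

Lemma wp_set s Q x e : fits W s e ->
  Q (rcost e).+1 (RState (upd (regs s) x (ev s e)) (arrs s) (output s)) ->
  wp W (RSet x e) s Q.
Proof. by move=> h q; do 2!eexists; split; last exact: q; constructor; apply: revalE. Qed.

Lemma wp_put s Q a e1 e2 : fits W s e1 -> fits W s e2 ->
  Q (rcost e1 + rcost e2).+1
    (RState (regs s) (upd (arrs s) a (upd (arrs s a) (ev s e1) (ev s e2))) (output s)) ->
  wp W (RPut a e1 e2) s Q.
Proof.
by move=> h1 h2 q; do 2!eexists; split; last exact: q; constructor; apply: revalE.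
Qed.

Lemma wp_emit s Q e : fits W s e ->
  Q (rcost e).+1 (RState (regs s) (arrs s) (rcons (output s) (ev s e))) ->
  wp W (REmit e) s Q.
Proof. by move=> h q; do 2!eexists; split; last exact: q; constructor; apply: revalE. Qed.

Lemma wp_seq s Q c1 c2 :
  wp W c1 s (fun t1 s1 => wp W c2 s1 (fun t2 s2 => Q (t1 + t2) s2)) ->
  wp W (RSeq c1 c2) s Q.
Proof.
move=> [t1 [s1 [h1 [t2 [s2 [h2 q]]]]]]; exists (t1 + t2), s2; split=> //.
exact: ExSeq h1 h2.
Qed.

Lemma wp_if s Q e c1 c2 : fits W s e ->
  (ev s e != 0 -> wp W c1 s (fun t s' => Q ((rcost e).+1 + t) s')) ->
  (ev s e = 0 -> wp W c2 s (fun t s' => Q ((rcost e).+1 + t) s')) ->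
  wp W (RIf e c1 c2) s Q.
Proof.
move=> h h1 h2; have r := revalE h; case: (eqVneq (ev s e) 0) => [z|nz].
  have [t [s' [x q]]] := h2 z; do 2!eexists; split; last exact: q.
  by apply: (ExIf r); rewrite z.
have [t [s' [x q]]] := h1 nz; do 2!eexists; split; last exact: q.
by apply: (ExIf r); rewrite nz.
Qed.

(** The list [l] is the work still to be done: each iteration consumes its head, which gives
    termination and charges the iteration to that element. The last summand pays for the failing
    test. *)
Lemma wp_while_seq (A : Type) (I : seq A -> rstate -> Prop) (cost : A -> nat) e c l s Q :
  I l s ->
  (forall x l' s', I (x :: l') s' ->
     [/\ fits W s' e, ev s' e != 0
       & wp W c s' (fun t s'' => t <= cost x /\ I l' s'')]) ->
  (forall s', I [::] s' -> fits W s' e /\ ev s' e = 0) ->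
  (forall t s', t <= \sum_(x <- l) (cost x + (rcost e).+1) + (rcost e).+1 ->
     I [::] s' -> Q t s') ->
  wp W (RWhile e c) s Q.
Proof.
move=> Il step stop post.
suff [t [s' [h [ht Is']]]] : wp W (RWhile e c) s (fun t s' =>
    t <= \sum_(x <- l) (cost x + (rcost e).+1) + (rcost e).+1 /\ I [::] s').
  by exists t, s'; split=> //; apply: post.
elim: l s Il {post} => [|x l IH] s Il.
  have [f z] := stop s Il; exists (rcost e).+1, s; split; last by rewrite big_nil.
  by apply: ExWhileStop; rewrite revalE // z.
have [f nz [t1 [s1 [h1 [ht1 I1]]]]] := step _ _ _ Il.
have [t2 [s2 [h2 [ht2 I2]]]] := IH _ I1.
exists ((rcost e).+1 + t1 + t2), s2; split; last by rewrite big_cons; split=> //; lia.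
exact: (ExWhileStep (revalE f) nz h1 h2).
Qed.

Lemma wp_while_nat (I : nat -> rstate -> Prop) (cost : nat -> nat) e c a b s Q :
  a <= b -> I a s ->
  (forall k s', a <= k < b -> I k s' ->
     [/\ fits W s' e, ev s' e != 0
       & wp W c s' (fun t s'' => t <= cost k /\ I k.+1 s'')]) ->
  (forall s', I b s' -> fits W s' e /\ ev s' e = 0) ->
  (forall t s', t <= \sum_(a <= k < b) (cost k + (rcost e).+1) + (rcost e).+1 ->
     I b s' -> Q t s') ->
  wp W (RWhile e c) s Q.
Proof.
move=> ab Ia step stop post.
(* The work remaining at counter value [k] is the list of the values from [k] to [b - 1]. *)
pose J l s' := exists2 k, a <= k <= b & l = index_iota k b /\ I k s'.
apply: (@wp_while_seq _ J cost e c (index_iota a b)).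
- by exists a; rewrite ?leqnn.
- move=> x l s' [k /andP[ak kb]]; rewrite /index_iota.
  case: (ltngtP k b) kb => // [kb _|->]; last by rewrite subnn => _ [].
  have -> : b - k = (b - k.+1).+1 by lia.
  move=> /= -[[-> ->] Ik].
  have [|f nz h] := step k s' _ Ik; first by rewrite ak.
  split=> //. apply: (wp_conseq h) => t s'' [ht Ik1]; split=> //.
  by exists k.+1; rewrite ?(leq_trans ak).
- move=> s' [k /andP[_ kb]] [/(congr1 size)]; rewrite size_iota /= => h Ik.
  by apply: stop; have -> : b = k by lia.
move=> t s' ht [k /andP[_ kb]] [/(congr1 size)]; rewrite size_iota /= => h Ik.
by apply: post => //; have -> : b = k by lia.
Qed.

End WP.

(** * The vertex ordering *)

Section Counting.
Variable A : Type.
Implicit Types (p q : pred A) (s : seq A).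

Lemma count_split p q1 q2 s :
  (forall y, p y = q1 y + q2 y :> nat) -> count p s = count q1 s + count q2 s.
Proof. by move=> h; elim: s => //= y s ->; rewrite h; lia. Qed.

Lemma count_le3 p q1 q2 q3 s : (forall y, p y -> [|| q1 y, q2 y | q3 y]) ->
  count p s <= count q1 s + count q2 s + count q3 s.
Proof. by move=> h; elim: s => //= y s; have := h y; lia. Qed.

End Counting.

Lemma ltn_count (A : eqType) (p q : pred A) (s : seq A) z : (forall y, p y -> q y) ->
  z \in s -> ~~ p z -> q z -> count p s < count q s.
Proof.
move=> h + pz qz; elim: s => //= y s IH; rewrite inE => /orP[/eqP<-|/IH].
  by rewrite qz (negbTE pz) /=; have := @sub_count _ p q h s; lia.
by have := h y; lia.
Qed.

Section Ordering.
Variables (n : nat) (col K H : nat -> nat).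
Implicit Types (u v y : nat).

(** The vertex number breaks ties, so that [precedes] is a strict total order. [K] and [H] will be
    doubled row numbers with a correction bit, and [K v < H u] the condition for an edge from [u] to
    [v] in the next column. *)
Definition before y v := (K y < K v) || ((K y == K v) && (y < v)).
Definition precedes y v := (col y < col v) || ((col y == col v) && before y v).
Definition rank v := count (fun y => precedes y v) (iota 0 n).
(** All earlier columns and [u] itself are included, neighbours or not, so that counting the reached
    vertices gives the first position beyond the later neighbours of [u]. *)
Definition reached u : pred nat :=
  fun y => (col y <= col u) || ((col y == (col u).+1) && (K y < H u)).
Definition reach u := count (reached u) (iota 0 n).
Definition col_size c := count (fun y => col y == c) (iota 0 n).
(** The reversal matches a linked list that is filled by insertion at its head. *)
Definition bucket k c := rev [seq v <- iota 0 k | col v == c].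

Lemma precedes_total u v : u != v -> precedes u v || precedes v u.
Proof. rewrite /precedes /before; lia. Qed.

Lemma precedes_trans u v y : precedes u v -> precedes v y -> precedes u y.
Proof. rewrite /precedes /before; lia. Qed.

Lemma precedesxx u : precedes u u = false.
Proof. rewrite /precedes /before; lia. Qed.

Lemma rank_lt u : u < n -> rank u < n.
Proof.
move=> un; rewrite -[X in _ < X](size_iota 0) -count_predT.
by apply: (@ltn_count _ _ _ _ u); rewrite ?precedesxx // mem_iota.
Qed.

Lemma rank_mono u v : u < n -> precedes u v -> rank u < rank v.
Proof.
move=> un uv; apply: (@ltn_count _ _ _ _ u); rewrite ?precedesxx ?mem_iota //.
by move=> y yu; apply: precedes_trans uv.
Qed.

Lemma rank_precedes u v : u < n -> v < n -> (rank u < rank v) = precedes u v.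
Proof.
move=> un vn; apply/idP/idP; last exact: rank_mono.
case: (eqVneq u v) => [->|/precedes_total/orP[//|/(rank_mono vn)]]; lia.
Qed.

Lemma rank_inj u v : u < n -> v < n -> rank u = rank v -> u = v.
Proof.
move=> un vn ruv; apply/eqP/negP => /negP/precedes_total/orP[];
by move/rank_mono; rewrite ruv ltnn; apply/implyP; rewrite ?un ?vn.
Qed.

(** Ranks are distinct and less than [n], so the [n] of them exhaust [iota 0 n]. *)
Lemma perm_rank : perm_eq [seq rank v | v <- iota 0 n] (iota 0 n).
Proof.
have u : uniq [seq rank v | v <- iota 0 n].
  rewrite map_inj_in_uniq ?iota_uniq // => x y.
  by rewrite !mem_iota !add0n => hx hy; apply: rank_inj.
apply: uniq_perm; rewrite ?iota_uniq //.
apply: (uniq_min_size u _ _).2; last by rewrite size_map.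
by move=> _ /mapP[v + ->]; rewrite !mem_iota !add0n; apply: rank_lt.
Qed.

Lemma rank_surj p : p < n -> exists2 v, v < n & rank v = p.
Proof.
move=> pn; have : p \in iota 0 n by rewrite mem_iota.
by rewrite -(perm_mem perm_rank) => /mapP[v]; rewrite mem_iota => vn ->; exists v.
Qed.

Lemma reach_le u : reach u <= n.
Proof. by rewrite -[X in _ <= X](size_iota 0); apply: count_size. Qed.

Lemma rank_lt_reach u : u < n -> rank u < reach u.
Proof.
move=> un; apply: (@ltn_count _ _ _ _ u); rewrite ?precedesxx ?mem_iota //.
  by move=> y; rewrite /precedes /reached; lia.
by rewrite /reached leqnn.
Qed.

(* [reached u] is an initial segment of the ordering. *)
Lemma reachedE u v : v < n -> (rank v < reach u) = reached u v.
Proof.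
move=> vn; apply/idP/idP => [|h].
  apply: contraTT => h; rewrite -leqNgt; apply: sub_count => y hy.
  by move: h hy; rewrite /precedes /before /reached; lia.
apply: (@ltn_count _ _ _ _ v); rewrite ?precedesxx ?mem_iota // => y.
by move: h; rewrite /precedes /before /reached; lia.
Qed.

(** The column of [u] is not later than that of [v], so whatever [u] reaches is before [v], in the
    column of [v] or in the next one. This bounds the range of ends scanned when [v] is inserted. *)
Lemma reach_near u v : precedes u v ->
  reach u <= rank v + col_size (col v) + col_size (col v).+1.
Proof.
by move=> uv; apply: count_le3 => y; move: uv; rewrite /precedes /before /reached; lia.
Qed.

Lemma mem_bucket k c v : (v \in bucket k c) = (v < k) && (col v == c).
Proof. by rewrite mem_rev mem_filter mem_iota andbC. Qed.

Lemma count_bucket p k c :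
  count p (bucket k c) = count (fun y => (col y == c) && p y) (iota 0 k).
Proof. by rewrite count_rev count_filter; apply: eq_count => y /=; rewrite andbC. Qed.

Lemma size_bucket c : size (bucket n c) = col_size c.
Proof. by rewrite size_rev size_filter. Qed.

Lemma bucketS k c : bucket k.+1 c = if col k == c then k :: bucket k c else bucket k c.
Proof.
rewrite /bucket -addn1 iotaD filter_cat rev_cat /= add0n.
by case: (col k == c).
Qed.

Lemma bucket_uniq k c : uniq (bucket k c).
Proof. by rewrite rev_uniq filter_uniq // iota_uniq. Qed.

Definition before_col c := count (fun y => col y < c) (iota 0 n).

Lemma before_colS c : before_col c.+1 = before_col c + col_size c.
Proof. by apply: count_split => y; lia. Qed.

(** The form in which [place_step] computes a position: an offset common to the column plus a count
    within one list. *)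
Lemma rank_bucket v :
  rank v = before_col (col v) + count (fun y => before y v) (bucket n (col v)).
Proof. by rewrite count_bucket; apply: count_split => y; rewrite /precedes; lia. Qed.

Lemma reach_bucket u : reach u = before_col (col u) + size (bucket n (col u))
   + count (fun y => K y < H u) (bucket n (col u).+1).
Proof.
rewrite size_bucket -before_colS count_bucket.
by apply: count_split => y; rewrite /reached; lia.
Qed.

End Ordering.

(** * Sorting the columns *)

Declare Scope rcmd_scope.
Delimit Scope rcmd_scope with RC.
Notation "c1 ;; c2" := (RSeq c1 c2) (at level 61, right associativity) : rcmd_scope.
Bind Scope rcmd_scope with rcmd.

(* [chain nx h l]: the linked list with head [h] and successor table [nx] spells
   [l]; a link stores the index plus one, and 0 ends the list. *)
Fixpoint chain (nx : nat -> nat) (h : nat) (l : seq nat) : Prop :=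
  if l is v :: l' then h = v.+1 /\ chain nx (nx v) l' else h = 0.

Lemma chain_upd nx h l v x : v \notin l -> chain nx h l -> chain (upd nx v x) h l.
Proof.
elim: l h => //= w l IH h; rewrite inE negb_or => /andP[vw vl] [-> c].
by split=> //; rewrite eq_sym (negbTE vw); apply: IH.
Qed.

Lemma chain_le nx h l m : chain nx h l -> all (fun v => v < m) l -> h <= m.
Proof. by case: l => [->|v l [-> _] /andP[]]. Qed.

Lemma sum_seq_const (A : Type) (l : seq A) k : \sum_(x <- l) k = size l * k.
Proof. by elim: l => [|x l IH]; rewrite ?big_nil ?big_cons //= IH mulSn. Qed.

Definition agree (rs : seq nat) (s s' : rstate) : Prop :=
  [/\ forall x, x \notin rs -> regs s' x = regs s x, arrs s' = arrs s
    & output s' = output s].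

Definition link_val (x : nat) : rexpr := RSub (RReg x) (RCst 1).
Definition incr (x : nat) : rcmd := RSet x (RAdd (RReg x) (RCst 1)).
Arguments link_val x /.
Arguments incr x /.

(* Register use: 0, 1 input; in [prepare] 2 = vertex; in [place] 2 = column,
   3, 4 = first position of this and of the next column, 5 = vertex (as a link),
   6 = its position, 7 = its end, 8 = list cursor; in [build] 2 = position,
   3 = largest end so far, 4 = new label, 5 = scanned end, 6 = end of the vertex.
   Arrays: 5 = [K], 6 = [H], 7, 8 = heads and links of the column lists,
   9 = end at a position, 10 = label of an end, 11 = whether a label is in use. *)
Definition prepare_step : rcmd :=
  (RPut 5 (RReg 2) (RAdd (RAdd (RGet 1 (RReg 2)) (RGet 1 (RReg 2)))
                        (RSub (RCst 1) (RGet 2 (RReg 2)))) ;;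
   RPut 6 (RReg 2) (RAdd (RAdd (RGet 1 (RReg 2)) (RGet 1 (RReg 2)))
                        (RGet 3 (RReg 2))) ;;
   RPut 8 (RReg 2) (RGet 7 (RGet 0 (RReg 2))) ;;
   RPut 7 (RGet 0 (RReg 2)) (RAdd (RReg 2) (RCst 1)) ;;
   incr 2)%RC.

Definition prepare : rcmd := RWhile (RSub (RReg 0) (RReg 2)) prepare_step.

(** Truncated subtraction serves as the comparison: two tests compare the keys both ways, and on a
    tie the third compares the vertex numbers, both shifted by one as links. Register 7 grows on
    every element, since the whole column is reached. *)
Definition scan_own : rcmd :=
  RWhile (RReg 8)
   (RIf (RSub (RGet 5 (link_val 5)) (RGet 5 (link_val 8))) (incr 6)
     (RIf (RSub (RGet 5 (link_val 8)) (RGet 5 (link_val 5))) RSkip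
       (RIf (RSub (RReg 5) (RReg 8)) (incr 6) RSkip)) ;;
    incr 7 ;;
    RSet 8 (RGet 8 (link_val 8)))%RC.

Definition scan_next : rcmd :=
  RWhile (RReg 8)
   (RIf (RSub (RGet 6 (link_val 5)) (RGet 5 (link_val 8))) (incr 7) RSkip ;;
    RSet 8 (RGet 8 (link_val 8)))%RC.

(** Position and end both start from the first position of the column; the own list contributes to
    both, the list of the next column to the end only. Register 4 advances once per vertex and so
    finishes at the start of the next column. *)
Definition place_step : rcmd :=
  (RSet 6 (RReg 3) ;; RSet 7 (RReg 3) ;; RSet 8 (RGet 7 (RReg 2)) ;;
   scan_own ;;
   RSet 8 (RGet 7 (RAdd (RReg 2) (RCst 1))) ;;
   scan_next ;;
   RPut 9 (RReg 6) (RReg 7) ;;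
   incr 4 ;;
   RSet 5 (RGet 8 (link_val 5)))%RC.

Definition place_column : rcmd :=
  (RSet 4 (RReg 3) ;; RSet 5 (RGet 7 (RReg 2)) ;;
   RWhile (RReg 5) place_step ;;
   RSet 3 (RReg 4) ;;
   incr 2)%RC.

Definition place : rcmd :=
  (RSet 2 (RCst 1) ;; RSet 3 (RCst 0) ;;
   RWhile (RSub (RAdd (RReg 1) (RCst 1)) (RReg 2)) place_column)%RC.

Ltac wp_step :=
  first [apply: wp_seq | apply: wp_skip
       | apply: wp_set => /= | apply: wp_put => /= | apply: wp_emit => /=
       | apply: wp_if => /=].

(** * Correctness and running time of the column sort *)

Section Sorting.
Variables (W n nc : nat) (col row sp tp : nat -> nat).
Hypothesis col_range : forall v, v < n -> 1 <= col v <= nc.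
Hypothesis row_le : forall v, v < n -> row v <= n.
Hypothesis sp_le : forall v, sp v <= 1.
Hypothesis tp_le : forall v, tp v <= 1.
Hypothesis nc_le : nc <= n.
Hypothesis W_ge : 2 * n + 10 <= W.

Let K v := row v + row v + (1 - sp v).
Let H v := row v + row v + tp v.

Lemma K_le v : v < n -> K v <= W.
Proof. by move=> vn; have := row_le vn; rewrite /K; lia. Qed.

Lemma H_le v : v < n -> H v <= W.
Proof. by move=> vn; have := row_le vn; have := tp_le v; rewrite /H; lia. Qed.

Record tables (i : nat) (s : rstate) : Prop := Tables {
  tab_n : regs s 0 = n;
  tab_nc : regs s 1 = nc;
  tab_K : forall v, v < i -> arrs s 5 v = K v;
  tab_H : forall v, v < i -> arrs s 6 v = H v;
  tab_chain : forall c, chain (arrs s 8) (arrs s 7 c) (bucket col i c) }.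

(** What [build] needs of the initial memory; the sorting phase only carries it along. *)
Definition blank (s : rstate) : Prop :=
  [/\ forall q, arrs s 10 q = 0, forall q, arrs s 11 q = 0 & output s = [::]].

Definition input (s : rstate) : Prop :=
  [/\ arrs s 0 = col, arrs s 1 = row, arrs s 2 = sp & arrs s 3 = tp].

Lemma bucket_lt i c : all (fun v => v < i) (bucket col i c).
Proof. by apply/allP => v; rewrite mem_bucket => /andP[]. Qed.

Lemma head_le i s c : tables i s -> arrs s 7 c <= i.
Proof. by move=> h; apply: chain_le (tab_chain h c) (bucket_lt i c). Qed.

Lemma wp_prepare s : tables 0 s -> input s -> regs s 2 = 0 -> blank s ->
  wp W prepare s (fun t s' => [/\ t <= 60 * n + 60, tables n s' & blank s']).
Proof.
move=> tab0 inp0 i0 bl0; rewrite /prepare.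
apply: (@wp_while_nat _ (fun i s' => [/\ tables i s', input s', regs s' 2 = i & blank s'])
  (fun _ => 50) _ _ 0 n) => //.
- move=> i {tab0 inp0 i0 bl0}s /andP[_ lin] [tab [c0 r0 s0 t0] ii bl].
  have /andP[_ lc] := col_range lin.
  have lr := row_le lin; have ls := sp_le i; have lt := tp_le i.
  have lh := head_le (col i) tab.
  have [tn tnc tK tH tC] := tab.
  rewrite /= tn ii; split; [lia|lia|].
  do !wp_step; rewrite ?c0 ?r0 ?s0 ?t0 ?ii ?c0 ?r0 ?s0 ?t0; try lia.
  split=> //; split=> //=.
    split=> //=.
    + move=> v vi; rewrite ?c0 ?r0 ?s0 ?t0; case: eqP => [->//|ne]; apply: tK; lia.
    + move=> v vi; rewrite ?c0 ?r0 ?s0 ?t0; case: eqP => [->//|ne]; apply: tH; lia.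
    + move=> c; rewrite ?c0 bucketS eq_sym.
      (* Vertex [i] belongs to no list yet, so writing its link disturbs none of them. *)
      have ch c' : chain (upd (arrs s 8) i (arrs s 7 (col i))) (arrs s 7 c') (bucket col i c').
        by apply: chain_upd; rewrite ?mem_bucket ?ltnn.
      case: eqP => [<-|_]; last exact: ch.
      by split; rewrite /= ?addn1 // eqxx; apply: ch.
  by rewrite addn1.
- move=> {tab0 inp0 i0 bl0}s [[tn _ _ _ _] _ ii _] /=; rewrite tn ii; split; lia.
- move=> t s' ht [tab _ _ bl]; split=> //.
  by move: ht; rewrite sum_nat_const_nat /=; lia.
Qed.

Lemma wp_scan_own s v l : tables n s -> v < n -> regs s 5 = v.+1 ->
  chain (arrs s 8) (regs s 8) l -> all (fun y => y < n) l ->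
  regs s 6 + size l < W -> regs s 7 + size l < W ->
  wp W scan_own s (fun t s' => [/\ t <= 60 * size l + 60,
    regs s' 6 = regs s 6 + count (fun y => before K y v) l,
    regs s' 7 = regs s 7 + size l & agree [:: 6; 7; 8] s s']).
Proof.
move=> tab vn xv ch ln b6 b7.
pose cb l := count (fun y => before K y v) l.
(* The invariant keeps each register plus the future contribution of the remaining list [l']
   constant. *)
apply: (@wp_while_seq _ _ (fun l' s' =>
  [/\ chain (arrs s 8) (regs s' 8) l', all (fun y => y < n) l',
      regs s' 6 + cb l' = regs s 6 + cb l, regs s' 7 + size l' = regs s 7 + size l
    & agree [:: 6; 7; 8] s s']) (fun _ => 50) _ _ l).
- by do !split.
- move=> y l' s' [/= [hy ch'] /andP[yn ln'] e6 e7 [ag ar ou]].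
  have x' : regs s' 5 = v.+1 by rewrite ag.
  have cbl : cb l <= size l by apply: count_size.
  have nl : arrs s 8 y <= n by apply: chain_le ch' ln'.
  have Ky := K_le yn; have Kv := K_le vn.
  rewrite /= hy; split; [lia|lia|].
  wp_step.
  set Q := (fun t1 s1 => _).
  (* All branches of the comparison share this continuation; each has only to show that register 6
     grew by the truth value of [before K y v]. *)
  have post t1 s1 : t1 <= 35 -> regs s1 6 = regs s' 6 + before K y v ->
      (forall x, x != 6 -> regs s1 x = regs s' x) -> arrs s1 = arrs s' ->
      output s1 = output s' -> Q t1 s1.
    move=> ht f6 fo fa fu; rewrite /Q {Q}.
    do !wp_step; rewrite ?fa ?ar ?f6 ?fo ?hy ?subn1 //=; try lia.
    split; first lia.
    split=> //=; rewrite ?f6 ?fo; try lia.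
    split=> //=; rewrite ?fa ?fu // => x.
    rewrite !inE !negb_or => /and3P[x6 x7 x8].
    by rewrite (negbTE x7) (negbTE x8) fo // ag // !inE !negb_or x6 x7.
  wp_step; rewrite ?ar ?x' ?hy ?subn1 /= ?(tab_K tab) //; try lia; move=> h1.
    wp_step; first lia.
    by apply: post => //= [|x]; [rewrite /before; lia|case: eqP].
  wp_step; rewrite /= ?ar ?x' ?hy ?subn1 /= ?(tab_K tab) //; try lia; move=> h2.
    wp_step.
    by apply: post => //=; rewrite /before; lia.
  wp_step; rewrite /= ?ar ?x' ?hy; try lia; move=> h3.
    wp_step; first lia.
    by apply: post => //= [|x]; [rewrite /before; lia|case: eqP].
  by wp_step; apply: post => //=; rewrite /before; lia.
- by move=> s' [/= h _ _ _ _]; rewrite h.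
move=> t s' ht [_ _ e6 e7 ag]; split=> //; rewrite /cb /= in e6 e7 *; try lia.
by move: ht; rewrite sum_seq_const /=; lia.
Qed.

Lemma wp_scan_next s v l : tables n s -> v < n -> regs s 5 = v.+1 ->
  chain (arrs s 8) (regs s 8) l -> all (fun y => y < n) l ->
  regs s 7 + size l < W ->
  wp W scan_next s (fun t s' => [/\ t <= 60 * size l + 60,
    regs s' 7 = regs s 7 + count (fun y => K y < H v) l & agree [:: 7; 8] s s']).
Proof.
move=> tab vn xv ch ln b7.
pose cb l := count (fun y => K y < H v) l.
apply: (@wp_while_seq _ _ (fun l' s' =>
  [/\ chain (arrs s 8) (regs s' 8) l', all (fun y => y < n) l',
      regs s' 7 + cb l' = regs s 7 + cb l & agree [:: 7; 8] s s']) (fun _ => 50) _ _ l).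
- by do !split.
- move=> y l' s' [/= [hy ch'] /andP[yn ln'] e7 [ag ar ou]].
  have x' : regs s' 5 = v.+1 by rewrite ag.
  have cbl : cb l <= size l by apply: count_size.
  have nl : arrs s 8 y <= n by apply: chain_le ch' ln'.
  have Ky := K_le yn; have Hv := H_le vn.
  rewrite /= hy; split; [lia|lia|].
  wp_step.
  set Q := (fun t1 s1 => _).
  have post t1 s1 : t1 <= 35 -> regs s1 7 = regs s' 7 + (K y < H v) ->
      (forall x, x != 7 -> regs s1 x = regs s' x) -> arrs s1 = arrs s' ->
      output s1 = output s' -> Q t1 s1.
    move=> ht f7 fo fa fu; rewrite /Q {Q}.
    do !wp_step; rewrite ?fa ?ar ?f7 ?fo ?hy ?subn1 //=; try lia.
    split; first lia.
    split=> //=; rewrite ?f7 ?fo; try lia.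
    split=> //=; rewrite ?fa ?fu // => x.
    by rewrite !inE !negb_or => /andP[x7 x8]; rewrite (negbTE x8) fo // ag // !inE !negb_or x7.
  wp_step; rewrite ?ar ?x' ?hy ?subn1 /= ?(tab_K tab) ?(tab_H tab) //; try lia; move=> h1.
    wp_step; first lia.
    by apply: post => //= [|x]; [lia|case: eqP].
  by wp_step; apply: post => //=; lia.
- by move=> s' [/= h _ _ _]; rewrite h.
move=> t s' ht [_ _ e7 ag]; split=> //; rewrite /cb /= in e7 *; try lia.
by move: ht; rewrite sum_seq_const /=; lia.
Qed.


Let rk := rank n col K.
Let ext := reach n col K H.
Let csz := col_size n col.
Let bcol := before_col n col.

Lemma csz_le c : csz c <= n.
Proof. by rewrite -[X in _ <= X](size_iota 0); apply: count_size. Qed.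

Lemma bcol_csz_le c : bcol c + csz c <= n.
Proof. by rewrite -before_colS -[X in _ <= X](size_iota 0); apply: count_size. Qed.

Lemma wp_place_step s v : tables n s -> blank s -> v < n ->
  regs s 5 = v.+1 -> regs s 2 = col v -> regs s 3 = bcol (col v) ->
  regs s 4 < n -> arrs s 8 v <= n ->
  wp W place_step s (fun t s' =>
    [/\ t <= 60 * (csz (col v) + csz (col v).+1) + 200, tables n s', blank s',
        [/\ regs s' 2 = regs s 2, regs s' 3 = regs s 3, regs s' 4 = (regs s 4).+1
          & regs s' 5 = arrs s 8 v]
      & arrs s' 9 = upd (arrs s 9) (rk v) (ext v) /\ arrs s' 8 = arrs s 8]).
Proof.
move=> tab bl vn x5 x2 x3 x4 nx.
have /andP[c1 cn] := col_range vn.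
have cc := bcol_csz_le (col v); have cs := csz_le (col v).+1.
have h1 := head_le (col v) tab; have h2 := head_le (col v).+1 tab.
rewrite /place_step; do 7!(wp_step; rewrite /= ?x2 ?x3; try lia).
apply: (wp_conseq (@wp_scan_own _ v (bucket col n (col v)) _ vn _ _ _ _ _)) => //=.
- by case: tab.
- exact: tab_chain.
- exact: bucket_lt.
- by rewrite size_bucket -/csz; lia.
- by rewrite size_bucket -/csz; lia.
move=> t1 s1 [ht1 e6 e7 [ag1 ar1 ou1]].
have g x : x \notin [:: 6; 7; 8] -> regs s1 x = regs s x.
  move=> hx; rewrite ag1 //=; move: hx; rewrite !inE !negb_or => /and3P[].
  by do 3!move=> /negbTE->.
rewrite size_bucket -/csz in e7 ht1.
do 3!(wp_step; rewrite /= ?ar1 ?(g 2) //= ?x2 ?addn1; try lia).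
apply: (wp_conseq (@wp_scan_next _ v (bucket col n (col v).+1) _ vn _ _ _ _)) => //=.
- case: tab => ? ? ? ? ?; split=> //=; by rewrite ?ar1 ?(g 0) ?(g 1).
- by rewrite g.
- by rewrite ?ar1; apply: tab_chain.
- exact: bucket_lt.
- by rewrite size_bucket -/csz; lia.
move=> t2 s2 [ht2 e7' [ag2 ar2 ou2]].
rewrite size_bucket -/csz in ht2.
have r2 : regs s2 6 = rk v by rewrite ag2 //= e6 /rk rank_bucket.
have r3 : regs s2 7 = ext v by rewrite e7' /= e7 /ext reach_bucket size_bucket.
have f x : x \notin [:: 6; 7; 8] -> regs s2 x = regs s x.
  move=> hx; rewrite ag2 /=; last by move: hx; rewrite !inE !negb_or => /and3P[_ -> ->].
  by case: eqP hx => [->//|_ hx]; rewrite g.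
have lr : rk v < n by apply: rank_lt.
have le : ext v <= n by apply: reach_le.
have a2 : arrs s2 = arrs s by rewrite ar2 /= ?ar1.
do !(wp_step; rewrite /= ?a2 ?r2 ?r3 ?(f 4) ?(f 5) //= ?x5 ?subn1 /=; try lia).
split=> //=; rewrite ?a2 ?r2 ?r3 ?(f 2) ?(f 3) ?(f 4) ?(f 5) //= ?addn1.
- by lia.
- by case: tab => ? ? ? ? ?; split=> //=; rewrite ?(f 0) ?(f 1) ?a2.
- by case: bl => ? ? ?; split=> //=; rewrite ?a2 // ou2 /= ou1.
- by split.
Qed.

Definition placed (P : pred nat) (s : rstate) : Prop :=
  forall v, v < n -> P v -> arrs s 9 (rk v) = ext v.

Lemma wp_place_column s c : 1 <= c <= nc -> tables n s -> blank s ->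
  regs s 2 = c -> regs s 3 = bcol c -> placed (fun v => col v < c) s ->
  wp W place_column s (fun t s' =>
    [/\ t <= csz c * (60 * (csz c + csz c.+1) + 210) + 100, tables n s', blank s',
        regs s' 2 = c.+1 /\ regs s' 3 = bcol c.+1
      & placed (fun v => col v < c.+1) s']).
Proof.
move=> /andP[c1 cn] tab bl x2 x3 pl.
have h1 := head_le c tab; have cc := bcol_csz_le c.
rewrite /place_column; do 5!(wp_step; rewrite /= ?x2 ?x3; try lia).
pose B := bucket col n c.
(* Here [l] is the part of the column still to be placed, so register 4 lags behind the start of the
   next column by [size l]. *)
apply: (@wp_while_seq _ _ (fun l s' =>
  [/\ tables n s', blank s', regs s' 2 = c /\ regs s' 3 = bcol c,
      [/\ regs s' 4 + size l = bcol c.+1, chain (arrs s' 8) (regs s' 5) l,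
          uniq l & {subset l <= B}]
    & placed (fun v => (col v < c) || ((col v == c) && (v \notin l))) s'])
  (fun _ => 60 * (csz c + csz c.+1) + 200) _ _ B) => //=.
- split=> //.
  + by case: tab.
  + split; rewrite ?bucket_uniq //; last exact: tab_chain.
    by rewrite size_bucket [RHS]before_colS.
  + move=> v vn /orP[|/andP[/eqP vc]]; first exact: pl.
    by rewrite mem_bucket vn vc eqxx.
- move=> v l s1 [tab1 bl1 [y2 y3] [y4 /= [y5 ch] /andP[vl ul] sl] pl1].
  have : v \in B by apply: sl; rewrite mem_head.
  rewrite mem_bucket => /andP[vn /eqP vc].
  have sl' : {subset l <= B} by move=> z zl; apply: sl; rewrite inE zl orbT.
  have la : all (fun y => y < n) l.
    by apply/allP => z /sl'; rewrite mem_bucket => /andP[].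
  rewrite /= y5; split; [lia|lia|].
  apply: (wp_conseq (@wp_place_step _ v tab1 bl1 vn _ _ _ _ _)) => //; rewrite ?vc //.
  + by have := bcol_csz_le c; rewrite -before_colS -/bcol; lia.
  + exact: chain_le ch la.
  move=> t s2 [ht tab2 bl2 [z2 z3 z4 z5] [z9 z8]]; split; first lia.
  split=> //; rewrite ?z2 ?z3 //.
    by split; rewrite ?z4 ?z5 ?z8 //; lia.
  move=> u un pu; rewrite z9 /=; case: (eqVneq u v) => [->|uv]; first by rewrite eqxx.
  (* Distinct vertices have distinct positions, so the new entry of array 9 overwrites no earlier
     one. *)
  case: eqP => [/(rank_inj un vn) /eqP|_]; first by rewrite (negbTE uv).
  by apply: pl1 => //; rewrite inE negb_or uv.
- by move=> s1 [_ _ _ [_ /= -> _ _] _].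
move=> t1 s1 ht1 [tab1 bl1 [y2 y3] [y4 _ _ _] pl1].
rewrite addn0 in y4; have := bcol_csz_le c; rewrite -before_colS -/bcol => bS.
do !(wp_step; rewrite /= ?y4 ?y2; try lia).
split=> //=; rewrite ?y2 ?y4 ?addn1 //.
- by move: ht1; rewrite sum_seq_const size_bucket -/csz; lia.
- by case: tab1.
by move=> v vn; rewrite ltnS leq_eqVlt orbC => h; apply: pl1 => //=; rewrite andbT.
Qed.

Lemma wp_place s : tables n s -> blank s ->
  wp W place s (fun t s' =>
    [/\ t <= \sum_(1 <= c < nc.+1) (csz c * (60 * (csz c + csz c.+1) + 210) + 110) + 20,
        regs s' 0 = n, blank s' & placed xpredT s']).
Proof.
move=> tab bl; rewrite /place; do 4!(wp_step; rewrite /=; try lia).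
apply: (@wp_while_nat _ (fun c s' => [/\ tables n s', blank s', regs s' 2 = c,
   regs s' 3 = bcol c & placed (fun v => col v < c) s'])
  (fun c => csz c * (60 * (csz c + csz c.+1) + 210) + 100) _ _ 1 nc.+1) => //=.
- split=> //=; first by case: tab.
    rewrite /bcol /before_col -[LHS](count_pred0 (iota 0 n)).
    apply: eq_in_count => v; rewrite mem_iota add0n => /col_range h /=; lia.
  by move=> v /col_range; lia.
- move=> c s1 /andP[c1 cn] [tab1 bl1 y2 y3 pl1].
  rewrite /= (tab_nc tab1) y2; split; [lia|lia|].
  apply: (wp_conseq (@wp_place_column _ c _ tab1 bl1 y2 y3 pl1)); first by rewrite c1.
  by move=> t s2 [ht tab2 bl2 [z2 z3] pl2]; split.
- by move=> s1 [tab1 bl1 y2 _ _]; rewrite /= (tab_nc tab1) y2; split; lia.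
move=> t s1 ht [tab1 bl1 y2 y3 pl1]; split=> //.
- rewrite addnA -[_ + 20]addnC.
  (* The two initial assignments cost 2 each; the remaining 16 covers the last loop test. *)
  have -> : 20 = 2 + 2 + 16 by [].
  rewrite -[2 + 2 + 16 + _]addnA leq_add2l; apply: leq_trans ht _.
  by rewrite addnC; apply: leq_add => //; apply: leq_sum => c _ /=; lia.
- by case: tab1.
by move=> v vn _; apply: pl1 => //; have := col_range vn; lia.
Qed.

End Sorting.

(** * Emitting the expression *)

Section Building.
Variable Lmax : nat.

(** The function [f] names the vertices of [e] by their positions; injectivity and the cardinality
    make it a bijection. Labels run from 0 to [Lmax], so [Lmax + 1] of them are available. *)
Definition built (p : nat) (A : rel nat) (lb : nat -> nat) (e : cwexpr) : Prop :=
  [/\ cw_wf e, all (fun l => l <= Lmax) (cw_labels e), #|cw_vertex e| = p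
    & exists f : nat -> cw_vertex e,
      [/\ forall x y, x < p -> y < p -> f x = f y -> x = y,
          forall x y, x < p -> y < p -> cw_adj (f x) (f y) = A x y
        & forall x, x < p -> cw_label (f x) = lb x]].

(** The encoding is postfix, so an operation on the expression built so far merely appends to the
    output. *)
Definition spells (p : nat) (A : rel nat) (lb : nat -> nat) (o : seq nat) : Prop :=
  exists2 e, built p A lb e & o = cw_encode e.

Lemma spells_ext p A lb A' lb' o :
  (forall x y, x < p -> y < p -> A' x y = A x y) -> (forall x, x < p -> lb' x = lb x) ->
  spells p A lb o -> spells p A' lb' o.
Proof.
move=> hA hl [e [wf la ca [f [fi fa fl]]] ->]; exists e => //; split=> //; exists f; split=> //.
  by move=> x y xp yp; rewrite hA // fa.
by move=> x xp; rewrite hl // fl.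
Qed.

Lemma spells_vertex A lb l : l <= Lmax -> A 0 0 = false -> lb 0 = l ->
  spells 1 A lb [:: 0; l].
Proof.
move=> lL A0 lb0; exists (CVertex l) => //; split=> //=; rewrite ?andbT ?card_unit //.
by exists (fun _ => tt); split=> [[|//] [|//]|[|//] [|//]|[|//]].
Qed.

Lemma spells_union p A lb A' lb' l o : l <= Lmax ->
  (forall x y, x < p -> y < p -> A' x y = A x y) ->
  (forall x, x <= p -> A' x p = false /\ A' p x = false) ->
  (forall x, x < p -> lb' x = lb x) -> lb' p = l ->
  spells p A lb o -> spells p.+1 A' lb' (o ++ [:: 0; l; 1]).
Proof.
move=> lL hA hp hl lp [e [wf la ca [f [fi fa fl]]] ->].
exists (CUnion e (CVertex l)) => //.
split=> /=; rewrite ?all_cat ?wf ?la ?card_sum ?ca ?card_unit ?addn1 //=; first by rewrite lL.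
exists (fun x => if x < p then inl (f x) else inr tt); split=> x.
- move=> y; rewrite !ltnS => xp yp; case: ltnP => hx; case: ltnP => hy //.
    by case=> /fi; apply.
  lia.
- move=> y; rewrite !ltnS => xp yp; case: ltnP => hx; case: ltnP => hy.
  + by rewrite fa // hA.
  + by have -> : y = p by [lia]; case: (hp x xp).
  + by have -> : x = p by [lia]; case: (hp y yp).
  by have -> : y = p by [lia]; case: (hp x xp).
rewrite ltnS => xp; case: ltnP => hx; first by rewrite fl // hl.
by rewrite -lp; congr lb'; lia.
Qed.

Lemma spells_relabel p A lb lb' i j o : i <= Lmax -> j <= Lmax ->
  (forall x, x < p -> lb' x = if lb x == i then j else lb x) ->
  spells p A lb o -> spells p A lb' (o ++ [:: 2; i; j]).
Proof.
move=> iL jL hl [e [wf la ca [f [fi fa fl]]] ->]; exists (CRelabel i j e) => //.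
split=> //=; first by rewrite iL jL.
by exists f; split=> // x xp; rewrite fl // hl.
Qed.

Lemma spells_join p A A' lb i j o : i <= Lmax -> j <= Lmax -> i != j ->
  (forall x y, x < p -> y < p -> A' x y =
     [|| A x y, (lb x == i) && (lb y == j) | (lb x == j) && (lb y == i)]) ->
  spells p A lb o -> spells p A' lb (o ++ [:: 3; i; j]).
Proof.
move=> iL jL ij hA [e [wf la ca [f [fi fa fl]]] ->]; exists (CJoin i j e) => //.
split=> //=; rewrite ?ij ?iL ?jL //.
by exists f; split=> // x y xp yp; rewrite !fl // fa // hA.
Qed.

End Building.

(** * The emission program *)

Definition free_label : rcmd := RWhile (RGet 11 (RReg 4)) (incr 4).

(** Every class whose end lies beyond the current position consists of neighbours of the new vertex,
    so joining its label to the new one creates correct edges only. *)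
Definition join_live : rcmd :=
  RWhile (RSub (RAdd (RReg 3) (RCst 1)) (RReg 5))
   (RIf (RGet 10 (RReg 5))
      (REmit (RCst 3) ;; REmit (RReg 4) ;; REmit (RGet 10 (RReg 5)))
      RSkip ;;
    incr 5)%RC.

(** Vertices whose end is the current position have no further neighbours; merging them into the
    dead label 0 frees their label. *)
Definition retire : rcmd :=
  RIf (RGet 10 (RReg 2))
   (REmit (RCst 2) ;; REmit (RGet 10 (RReg 2)) ;; REmit (RCst 0) ;;
    RPut 11 (RGet 10 (RReg 2)) (RCst 0))%RC
   RSkip.

Definition enroll : rcmd :=
  RIf (RGet 10 (RReg 6))
   (REmit (RCst 2) ;; REmit (RReg 4) ;; REmit (RGet 10 (RReg 6)))%RC
   (RPut 10 (RReg 6) (RReg 4) ;; RPut 11 (RReg 4) (RCst 1))%RC.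

Definition build_step : rcmd :=
  (retire ;;
   RSet 4 (RCst 1) ;; free_label ;;
   REmit (RCst 0) ;; REmit (RReg 4) ;; RIf (RReg 2) (REmit (RCst 1)) RSkip ;;
   RSet 5 (RAdd (RReg 2) (RCst 1)) ;; join_live ;;
   RSet 6 (RGet 9 (RReg 2)) ;; enroll ;;
   RIf (RSub (RReg 6) (RReg 3)) (RSet 3 (RReg 6)) RSkip ;;
   incr 2)%RC.

Definition build : rcmd :=
  (RSet 2 (RCst 0) ;; RSet 3 (RCst 0) ;;
   RWhile (RSub (RReg 0) (RReg 2)) build_step)%RC.

(** * Label bookkeeping and correctness of the emission *)

Section Emission.
Variables (W n Lmax : nat) (E : nat -> nat).
Hypothesis E_range : forall x, x < n -> x < E x <= n.
Hypothesis Lmax_le : Lmax <= n.+1.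
Hypothesis W_ge : 2 * n + 10 <= W.

(** These are the ends of the earlier neighbours of [p]; the group number will bound how many there
    are. *)
Definition live p := undup [seq E x | x <- iota 0 p & p < E x].
Hypothesis live_lt : forall p, p < n -> size (live p) < Lmax.

Definition far p := \max_(0 <= x < p) E x.

Lemma farS p : far p.+1 = maxn (far p) (E p).
Proof. by rewrite /far big_nat_recr. Qed.

Lemma far_le p : p <= n -> far p <= n.
Proof.
elim: p => [|p IH] pn; first by rewrite /far big_nil.
by rewrite farS geq_max IH ?(ltnW pn) //; have := E_range pn; lia.
Qed.

Lemma leq_far p x : x < p -> E x <= far p.
Proof.
elim: p => // p IH; rewrite ltnS farS leq_eqVlt => /orP[/eqP->|/IH]; rewrite leq_max.
  by rewrite leqnn orbT.
by move->.
Qed.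

Definition order_adj x y := if x < y then y < E x else (y < x) && (x < E y).

(* The classes of end [q >= d] hold label [lab q]; [lab q = 0] means that there is none. *)
Record labelling (d p : nat) (lab used : nat -> nat) : Prop := Labelling {
  lab_class : forall q, d <= q -> (lab q != 0) <-> (exists2 x, x < p & E x = q);
  lab_inj : forall q q', d <= q -> d <= q' -> lab q != 0 -> lab q = lab q' -> q = q';
  lab_used : forall l, l != 0 -> (used l != 0) <-> (exists2 q, d <= q & lab q = l);
  lab_le : forall q, d <= q -> lab q <= Lmax;
  lab_bit : forall l, used l <= 1 }.

(** A build step passes from [labelling p p] through [labelling p.+1 p], where end [p] is discarded
    but vertex [p] is not yet entered, to [labelling p.+1 p.+1]. *)
Lemma labelling_skip p lab used : lab p = 0 ->
  labelling p p lab used -> labelling p.+1 p lab used.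
Proof.
move=> l0 [h1 h2 h3 h4 h5]; split=> [q pq|q q' pq pq'|l l1|q pq|//].
- exact/h1/ltnW.
- by apply: h2; apply: ltnW.
- rewrite h3 //; split=> -[q pq lq]; exists q => //; last exact: ltnW.
  rewrite ltn_neqAle pq andbT; by apply: contra_neq l1 => e; rewrite -lq -e.
- exact/h4/ltnW.
Qed.

(** The entry [lab p] may stay: only ends from [p.+1] on are constrained, and by injectivity none of
    these carries the released label. *)
Lemma labelling_retire p lab used : lab p != 0 ->
  labelling p p lab used -> labelling p.+1 p lab (upd used (lab p) 0).
Proof.
move=> l0 [h1 h2 h3 h4 h5]; split=> [q pq|q q' pq pq'|l l1 /=|q pq|l /=].
- exact/h1/ltnW.
- by apply: h2; apply: ltnW.
- case: (eqVneq l (lab p)) => [->|/eqP ne].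
    split=> // -[q pq lq]; have := h2 p q (leqnn p) (ltnW pq) l0 (esym lq); lia.
  rewrite h3 //; split=> -[q pq lq]; exists q => //; last exact: ltnW.
  by rewrite ltn_neqAle pq andbT; apply/eqP => e; case: ne; rewrite -lq e.
- exact/h4/ltnW.
- by case: eqP.
Qed.

(** If the labels 1 to [k] are all in use, they come from [k] distinct ends, which lie in [live p]
    and between [p.+1] and [far p]. The first bound keeps the new label within [Lmax]; the second
    pays for the search. *)
Lemma free_label_exists p lab used : p < n -> labelling p.+1 p lab used ->
  exists l, [/\ 1 <= l <= Lmax, l <= (far p - p).+1, used l = 0
              & forall k, 1 <= k < l -> used k != 0].
Proof.
move=> pn [h1 h2 h3 h4 h5].
have bound k : (forall j, 1 <= j <= k -> used j != 0) -> k <= size (live p) /\ k <= far p - p.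
  move=> hk; pose Q := [seq q <- iota p.+1 (far p - p) | lab q != 0].
  have kQ : k <= size Q.
    rewrite -(size_iota 1 k) -(size_map lab Q); apply: uniq_leq_size; first exact: iota_uniq.
    move=> j; rewrite mem_iota => /andP[j1 jk].
    have [||q pq lq] := (h3 j _).1; [by lia|by apply: hk; lia|].
    have nq : lab q != 0 by rewrite lq; lia.
    apply/mapP; exists q => //; rewrite mem_filter nq mem_iota pq /=.
    by have [x xp Ex] := (h1 q pq).1 nq; have := leq_far xp; lia.
  split; apply: leq_trans kQ _.
    apply: uniq_leq_size; first by rewrite filter_uniq // iota_uniq.
    move=> q; rewrite mem_filter mem_iota => /and3P[nq pq _].
    have [x xp Ex] := (h1 q pq).1 nq.
    by rewrite mem_undup; apply/mapP; exists x; rewrite // mem_filter Ex pq mem_iota.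
  by rewrite size_filter (leq_trans (count_size _ _)) // size_iota.
have ex : exists l, (0 < l) && (used l == 0).
  apply: contrapT => no.
  have [|b _] := bound (size (live p)).+1; last lia.
  move=> j /andP[j1 _]; apply/negP => u0; apply: no; exists j; by rewrite j1.
case: (ex_minnP ex) => l /andP[l0 /eqP ul] lmin; exists l.
have pre k : 1 <= k < l -> used k != 0.
  by move=> /andP[k1 kl]; apply/negP => uk; have := lmin k; rewrite k1 uk => /(_ isT); lia.
have [b1 b2] := bound l.-1 (fun j jl => pre j ltac:(lia)).
by have := live_lt pn; split=> //; lia.
Qed.

Lemma labelling_join p lab used : p < n -> lab (E p) != 0 ->
  labelling p.+1 p lab used -> labelling p.+1 p.+1 lab used.
Proof.
move=> pn lE [h1 h2 h3 h4 h5]; split=> // q pq; rewrite h1 //.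
split=> -[x xp xq]; first by exists x => //; apply: ltnW.
move: xp; rewrite ltnS leq_eqVlt => /orP[/eqP xp|]; last by exists x.
by apply/h1 => //; rewrite -xq xp.
Qed.

Lemma labelling_new p lab used l : p < n -> lab (E p) = 0 -> 1 <= l <= Lmax ->
  used l = 0 -> labelling p.+1 p lab used ->
  labelling p.+1 p.+1 (upd lab (E p) l) (upd used l 1).
Proof.
move=> pn lE /andP[l1 lL] ul [h1 h2 h3 h4 h5].
have nl q : p < q -> lab q <> l.
  by move=> pq e; have := (h3 l _).2 (ex_intro2 _ _ q pq e); rewrite ul; lia.
have pE := E_range pn.
split=> [q pq /=|q q' pq pq' /=|k k1 /=|q pq /=|k /=]; last by case: eqP.
- case: (eqVneq q (E p)) => [->|/eqP ne]; first by split=> [_|]; [exists p|lia].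
  rewrite h1 //; split=> -[x xp xq]; exists x => //; first exact: ltnW.
  by move: xp; rewrite ltnS leq_eqVlt => /orP[/eqP xp|//]; case: ne; rewrite -xq xp.
- case: (eqVneq q (E p)) => [->|_]; case: (eqVneq q' (E p)) => [->//|_].
  + by move=> _ e; case: (nl q').
  + by move=> _ e; case: (nl q).
  exact: h2.
- case: (eqVneq k l) => [->|/eqP ne].
    by split=> // _; exists (E p); rewrite ?eqxx //; lia.
  rewrite h3 //; split=> -[q pq lq]; exists q => //.
    by case: eqP => // e; move: k1; rewrite -lq e lE.
  by move: lq; case: eqP => // _ e; case: ne.
- by case: eqP => // _; apply: h4.
Qed.

Definition class_label p (lab : nat -> nat) x := if p <= E x then lab (E x) else 0.

(** The graph in the middle of the join loop for vertex [p]: of the edges from [p] to earlier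
    vertices, those to ends from [q] on are still missing. *)
Definition partial_adj p q x y :=
  order_adj x y && ((maxn x y == p) ==> (E (minn x y) < q)).

Lemma wp_free_label s l : regs s 4 = 1 -> 1 <= l <= n.+1 -> arrs s 11 l = 0 ->
  (forall k, 1 <= k <= l -> arrs s 11 k <= 1) ->
  (forall k, 1 <= k < l -> arrs s 11 k != 0) ->
  wp W free_label s (fun t s' => [/\ t <= 10 * l, regs s' 4 = l & agree [:: 4] s s']).
Proof.
move=> r4 /andP[l1 ln] ul u1 uk.
apply: (@wp_while_nat _ (fun k s' => regs s' 4 = k /\ agree [:: 4] s s')
  (fun _ => 4) _ _ 1 l) => //.
- move=> k s1 /andP[k1 kl] [e4 [ag ar ou]].
  have := u1 k; have := uk k; rewrite k1 kl ltnW // => /(_ isT) uk' /(_ isT) u1'.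
  rewrite /= e4 ar; split=> //; first by lia.
  wp_step; first by rewrite e4; lia.
  split=> //; split=> /=; first by rewrite e4 addn1.
  by split=> //= x hx; rewrite -ag //; move: hx; rewrite inE => /negbTE->.
- by move=> s1 [e4 [ag ar ou]]; rewrite /= e4 ar ul; split; lia.
move=> t s1 ht [e4 ag]; split=> //.
by move: ht; rewrite sum_nat_const_nat /=; lia.
Qed.

Lemma wp_join_live s p l : p < n -> regs s 3 = far p -> regs s 4 = l -> regs s 5 = p.+1 ->
  1 <= l <= Lmax -> arrs s 11 l = 0 -> labelling p.+1 p (arrs s 10) (arrs s 11) ->
  let lb x := if x == p then l else class_label p.+1 (arrs s 10) x in
  spells Lmax p.+1 (partial_adj p p.+1) lb (output s) ->
  wp W join_live s (fun t s' => [/\ t <= 40 * (far p - p) + 40,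
    spells Lmax p.+1 order_adj lb (output s'),
    forall x, x != 5 -> regs s' x = regs s x & arrs s' = arrs s]).
Proof.
move=> pn r3 r4 r5 /andP[l1 lL] ul labs lb sp0.
have fn : far p <= n by apply: far_le; apply: ltnW.
have nl q : p < q -> arrs s 10 q <> l.
  by move=> pq e; have := (lab_used labs _).2 (ex_intro2 _ _ q pq e); rewrite ul; lia.
(* The counter [q] is the next end to scan. The upper limit is a maximum because [far p] may be at
   most [p], leaving nothing to scan. *)
apply: (@wp_while_nat _ (fun q s' => [/\ regs s' 5 = q,
  spells Lmax p.+1 (partial_adj p q) lb (output s'),
  forall x, x != 5 -> regs s' x = regs s x & arrs s' = arrs s])
  (fun _ => 24) _ _ p.+1 (maxn p.+1 (far p).+1)) => //.
- exact: leq_maxl.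
- move=> q s1 /andP[pq qf] [e5 sp ag ar].
  have lq := lab_le labs pq.
  have qp : q <= far p by lia.
  rewrite /= ag // r3 e5; split; [lia|lia|].
  wp_step; wp_step; rewrite ?e5 ?ar; first lia.
    move=> nq; do !(wp_step; rewrite /= ?e5 ?ar ?(ag 4) ?r4 //; try lia).
    split=> //; split=> //=; rewrite ?e5 ?addn1 //.
      rewrite -!cats1 -!catA /=; apply: spells_join sp; rewrite ?lL //.
        by apply/eqP => e; case: (nl q).
      move=> x y; rewrite !ltnS => xp yp.
      have lbE z : z <= p -> (lb z == l) = (z == p).
        rewrite /lb /class_label; case: (eqVneq z p) => [->|zp] zl; first by rewrite eqxx.
        by case: ltnP => hz; apply/eqP => // e; [case: (nl (E z))|lia].
      (* Live classes have distinct nonzero labels and dead vertices have label 0, so only the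
         earlier vertices with end [q] hold this one. *)
      have lbQ z : z <= p -> (lb z == arrs s 10 q) = (z != p) && (E z == q).
        rewrite /lb /class_label; case: (eqVneq z p) => [->|zp] zl /=.
          by apply/eqP => e; case: (nl q).
        case: (ltnP p (E z)) => hz; last by rewrite eq_sym (negbTE nq); lia.
        apply/eqP/eqP => [e|->//]; apply/esym/(lab_inj labs) => //.
      rewrite !lbE // !lbQ // /partial_adj /order_adj.
      case: (eqVneq x p) => [->|xp']; case: (eqVneq y p) => [->|yp'] /=.
      + by rewrite ltnn maxnn eqxx.
      + have -> : maxn p y = p by lia.
        have -> : minn p y = y by lia.
        have -> : y < p by lia.
        have -> : (p < y) = false by lia.
        by rewrite eqxx /=; lia.
      + have -> : maxn x p = p by lia.
        have -> : minn x p = x by lia.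
        have -> : x < p by lia.
        by rewrite eqxx /=; lia.
      by have -> : (maxn x y == p) = false by [lia]; rewrite !andbF !orbF.
    by move=> x x5; rewrite (negbTE x5) ag.
  move=> nq; do !(wp_step; rewrite /= ?e5 //; try lia).
  split=> //; split=> //=; rewrite ?e5 ?addn1 //; last first.
    by move=> x x5; rewrite (negbTE x5) ag.
  (* No earlier vertex has end [q], so the partial graphs for [q] and [q.+1] agree. *)
  apply: spells_ext sp => // x y; rewrite !ltnS => xp yp.
  have Eq z : z < p -> E z != q.
    move=> zp; apply/eqP => e; have := (lab_class labs pq).2 (ex_intro2 _ _ z zp e).
    by rewrite nq.
  rewrite /partial_adj /order_adj; case: (eqVneq (maxn x y) p) => //= m.
  by case: (ltngtP x y) => // xy; [have := Eq x|have := Eq y]; lia.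
- by move=> s1 [e5 sp ag ar]; rewrite /= ag // r3 e5; split; lia.
move=> t s1 ht [e5 sp ag ar]; split=> //.
  by move: ht; rewrite sum_nat_const_nat /=; lia.
apply: spells_ext sp => // x y; rewrite !ltnS => xp yp.
rewrite /partial_adj /order_adj; case: (eqVneq (maxn x y) p) => //= m; rewrite ?andbT //.
by case: (ltngtP x y) => //= xy; [have := @leq_far p x|have := @leq_far p y]; lia.
Qed.

(** No expression denotes the empty graph, so the output is empty before the first vertex, which is
    then emitted without a union. *)
Definition started p lb o :=
  if p is 0 then o = [::] else spells Lmax p order_adj lb o.

Lemma started_vertex p lb lb' l o o' : l <= Lmax -> started p lb o ->
  (forall x, x < p -> lb' x = lb x) -> lb' p = l ->
  o' = o ++ (if p is 0 then [:: 0; l] else [:: 0; l; 1]) ->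
  spells Lmax p.+1 (partial_adj p p.+1) lb' o'.
Proof.
move=> lL; case: p => [|p] /= sp hl lp ->; first by rewrite sp; apply: spells_vertex.
apply: spells_union sp => // x.
  by move=> y xp yp; rewrite /partial_adj; have -> : (maxn x y == p.+1) = false by [lia];
     rewrite andbT.
move=> xp; rewrite /partial_adj /order_adj maxnC minnC.
have -> : maxn p.+1 x = p.+1 by lia.
have -> : minn p.+1 x = x by lia.
by rewrite eqxx /=; case: (ltngtP x p.+1) xp => // *; split; lia.
Qed.

Lemma wp_retire s p : p < n -> regs s 2 = p -> labelling p p (arrs s 10) (arrs s 11) ->
  started p (class_label p (arrs s 10)) (output s) ->
  wp W retire s (fun t s' => [/\ t <= 20, regs s' = regs s,
    arrs s' 9 = arrs s 9 /\ arrs s' 10 = arrs s 10,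
    labelling p.+1 p (arrs s' 10) (arrs s' 11)
    & started p (class_label p.+1 (arrs s' 10)) (output s')]).
Proof.
move=> pn r2 labs st; have lp := lab_le labs (leqnn p).
wp_step; rewrite r2; first lia.
  move=> np; do !(wp_step; rewrite /= ?r2; try lia).
  split=> //=; first exact: labelling_retire.
  (* A class to be retired has a member, so [p] is positive and the output already spells an
     expression. *)
  have [z zp _] := (lab_class labs (leqnn p)).1 np.
  case: p {pn} r2 labs st lp np zp => // p r2 labs st lp np _.
  rewrite -!cats1 -!catA /=; apply: spells_relabel st => // x xp.
  rewrite /class_label; case: (ltngtP p.+1 (E x)) => [h|h|<-].
  - case: eqP => // e; have := lab_inj labs (ltnW h) (leqnn _); rewrite e => /(_ np erefl); lia.
  - by rewrite eq_sym (negbTE np).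
  - by rewrite eqxx.
move=> np; wp_step; split=> //=; first exact: labelling_skip.
case: p {pn lp} r2 labs st np => // p r2 labs st np.
apply: spells_ext st => // x xp; rewrite /class_label; case: (ltngtP p.+1 (E x)) => // <-.
by rewrite np.
Qed.

Lemma wp_enroll s p l : p < n -> regs s 6 = E p -> regs s 4 = l -> 1 <= l <= Lmax ->
  arrs s 11 l = 0 -> labelling p.+1 p (arrs s 10) (arrs s 11) ->
  spells Lmax p.+1 order_adj
    (fun x => if x == p then l else class_label p.+1 (arrs s 10) x) (output s) ->
  wp W enroll s (fun t s' => [/\ t <= 20, regs s' = regs s, arrs s' 9 = arrs s 9,
    labelling p.+1 p.+1 (arrs s' 10) (arrs s' 11)
    & spells Lmax p.+1 order_adj (class_label p.+1 (arrs s' 10)) (output s')]).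
Proof.
move=> pn r6 r4 /andP[l1 lL] ul labs sp.
have /andP[pE En] := E_range pn.
have lp := lab_le labs pE.
have nl q : p < q -> arrs s 10 q <> l.
  by move=> pq e; have := (lab_used labs _).2 (ex_intro2 _ _ q pq e); rewrite ul; lia.
wp_step; rewrite r6; first lia.
  move=> np; do !(wp_step; rewrite /= ?r6 ?r4; try lia).
  split=> //=; first exact: labelling_join.
  rewrite -!cats1 -!catA /=; apply: spells_relabel sp => // x xp.
  case: (eqVneq x p) => [->|xp']; first by rewrite eqxx /class_label pE.
  case: eqP => // e; move: e; rewrite /class_label; case: ltnP => // h e; last lia.
  by case: (nl _ h).
move=> np; do !(wp_step; rewrite /= ?r6 ?r4; try lia).
split=> //=; first by apply: labelling_new => //; rewrite l1.
apply: spells_ext sp => // x xp; rewrite /class_label.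
case: (eqVneq x p) => [->|xp']; first by rewrite pE /= eqxx.
case: ltnP => //= h; case: eqP => // e.
have xp2 : x < p by lia.
by have := (lab_class labs pE).2 (ex_intro2 _ _ x xp2 e); rewrite np.
Qed.

Record progress (p : nat) (s : rstate) : Prop := Progress {
  prog_n : regs s 0 = n;
  prog_p : regs s 2 = p;
  prog_far : regs s 3 = far p;
  prog_E : forall x, x < n -> arrs s 9 x = E x;
  prog_lab : labelling p p (arrs s 10) (arrs s 11);
  prog_out : started p (class_label p (arrs s 10)) (output s) }.

Lemma wp_build_step s p : p < n -> progress p s ->
  wp W build_step s (fun t s' => t <= 50 * (far p - p) + 200 /\ progress p.+1 s').
Proof.
move=> pn [r0 r2 r3 aE labs st]; rewrite /build_step.
have /andP[pE En] := E_range pn.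
wp_step; apply: (wp_conseq (wp_retire pn r2 labs st)) => t1 s1 [ht1 rg1 [a9 a10] labs1 st1].
have [l [/andP[l1 lL] lf ul uk]] := free_label_exists pn labs1.
do 3!(wp_step; rewrite /=; try lia).
apply: (wp_conseq (@wp_free_label _ l _ _ _ _ _)) => //=; first lia.
  by move=> k _; have := lab_bit labs1 k.
move=> t2 s2 [ht2 e4 [ag2 ar2 ou2]].
have f2 x : x != 4 -> regs s2 x = regs s x.
  by move=> x4; rewrite ag2 ?inE //= (negbTE x4) rg1.
rewrite /= in ar2 ou2.
do 5!(wp_step; rewrite /= ?e4 ?(f2 2) //= ?r2; try lia).
set Q := (fun t0 s0 => _).
(* Both cases of the optional union meet in this continuation. *)
suff post t3 s3 : t3 <= 10 -> regs s3 = regs s2 -> arrs s3 = arrs s1 ->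
    output s3 = output s1 ++ (if p is 0 then [:: 0; l] else [:: 0; l; 1]) -> Q t3 s3.
  wp_step; rewrite /= ?(f2 2) // r2; first lia.
    move=> p0; wp_step; first lia.
    apply: post => //=; rewrite ou2 -!cats1 -!catA /=.
    by case: (p) p0.
  by move=> p0; wp_step; apply: post => //=; rewrite ou2 -!cats1 -!catA /= p0.
move=> ht3 rg3 ar3 ou3; rewrite /Q {Q}.
have g x : x != 4 -> regs s3 x = regs s x by move=> x4; rewrite rg3 f2.
do 3!(wp_step; rewrite /= ?(g 2) //= ?r2; try lia).
apply: (wp_conseq (@wp_join_live _ p l pn _ _ _ _ _ _ _)) => //=; rewrite ?ar3 ?ou3 //.
- by rewrite g.
- by rewrite rg3.
- by rewrite addn1.
- by rewrite l1.
- apply: (started_vertex lL st1 _ _ erefl) => [x xp|]; last by rewrite eqxx.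
  by have -> : (x == p) = false by lia.
move=> t4 s4 [ht4 sp4 ag4 ar4].
have g4 x : x != 4 -> x != 5 -> regs s4 x = regs s x.
  by move=> x4 x5; rewrite ag4 //= (negbTE x5) g.
do 3!(wp_step; rewrite /= ?ar4 ?(g4 2) //= ?r2 ?a9 ?aE //; try lia).
apply: (wp_conseq (@wp_enroll _ p l pn _ _ _ _ _ _)) => //=; rewrite ?ar4 ?l1 //.
- by rewrite ag4 //= rg3.
move=> t5 s5 [ht5 rg5 a95 labs5 sp5].
have g5 x : x != 4 -> x != 5 -> x != 6 -> regs s5 x = regs s x.
  by move=> x4 x5 x6; rewrite rg5 /= (negbTE x6) g4.
have x6 : regs s5 6 = E p by rewrite rg5.
have fn : far p <= n by apply: far_le; apply: ltnW.
have a95' x : x < n -> arrs s5 9 x = E x by move=> xn; rewrite a95 ?ar4 ?a9 aE.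
wp_step; wp_step; rewrite /= ?x6 ?(g5 3) //= ?r3; try lia; move=> hf.
  do !(wp_step; rewrite /= ?x6 ?(g5 2) //= ?r2; try lia).
  split; first lia.
  split=> //=; rewrite ?(g5 0) ?(g5 2) //= ?r2 ?addn1 //.
  by rewrite farS; lia.
do !(wp_step; rewrite /= ?x6 ?(g5 2) //= ?r2; try lia).
split; first lia.
split=> //=; rewrite ?(g5 0) ?(g5 2) ?(g5 3) //= ?r2 ?addn1 //.
by rewrite farS r3; lia.
Qed.

Lemma wp_build s : regs s 0 = n -> (forall x, x < n -> arrs s 9 x = E x) -> blank s ->
  0 < n ->
  wp W build s (fun t s' => t <= \sum_(0 <= p < n) (50 * (far p - p) + 210) + 20 /\
    spells Lmax n order_adj (fun x => if n <= E x then arrs s' 10 (E x) else 0) (output s')).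
Proof.
move=> r0 aE [l0 u0 o0] n0; rewrite /build; do 4!(wp_step; rewrite /=; try lia).
apply: (@wp_while_nat _ progress (fun p => 50 * (far p - p) + 200) _ _ 0 n) => //.
- split=> //=; first by rewrite /far big_nil.
  split=> [q _|q q' _ _|l nl|q _|l]; rewrite ?l0 ?u0 //; first by split=> // -[].
  by split=> // -[q _]; rewrite l0 => e; rewrite -e in nl.
- move=> p s1 /andP[_ pn] pr; have [r0' r2 _ _ _ _] := pr.
  by rewrite /= r0' r2; split; [lia|lia|]; apply: wp_build_step.
- by move=> s1 [r0' r2 _ _ _ _]; rewrite /= r0' r2; split; lia.
move=> t s1 ht pr; split; last by have := prog_out pr; case: (n) n0.
rewrite addnA -[_ + 20]addnC.
have -> : 20 = 2 + 2 + 16 by [].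
rewrite -[2 + 2 + 16 + _]addnA leq_add2l; apply: leq_trans ht _.
by rewrite addnC; apply: leq_add => //; apply: leq_sum => c _ /=; lia.
Qed.

End Emission.

(** * Bubble models *)

Section Degrees.
Variable T : finType.

(** An ordered adjacent pair is recovered from its edge and one bit, the order of its two vertices
    in the enumeration of [T]. *)
Lemma sum_degree_le (G : sgraph T) : \sum_v #|nbh G v| <= 2 * #|edges G|.
Proof.
pose P := [set p : T * T | G p.1 p.2].
have -> : \sum_v #|nbh G v| = #|P|.
  rewrite -sum1_card (eq_bigl (fun p : T * T => predT p.1 && G p.1 p.2)); last first.
    by move=> p; rewrite inE.
  rewrite -(pair_big_dep predT (fun x y => G x y) (fun _ _ => 1)) /=.
  by apply: eq_bigr => v _; rewrite sum1_card; apply: eq_card => u; rewrite inE.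
pose f (p : T * T) := ([set p.1; p.2], enum_rank p.1 < enum_rank p.2).
have fi : {in P &, injective f}.
  move=> [x y] [z w]; rewrite !inE /= => xy zw [/setP e b].
  have := e x; have := e y; have := e z; rewrite !inE !eqxx ?orbT /=.
  have nxy : x != y by apply: contraTneq xy => ->; rewrite adj_irr.
  have nzw : z != w by apply: contraTneq zw => ->; rewrite adj_irr.
  move=> /orP[]/eqP zE; last first.
    subst z => _; rewrite (negbTE nxy) /= => /esym/eqP xw; subst w.
    move: b; case: ltngtP => // /val_inj/enum_rank_inj/eqP.
    by rewrite (negbTE nxy).
  by subst z; rewrite [y == x]eq_sym (negbTE nxy) /= => /esym/eqP->.
have -> : 2 * #|edges G| = #|setX (edges G) [set: bool]|.
  by rewrite cardsX cardsT card_bool mulnC.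
rewrite -(card_in_imset fi); apply: subset_leq_card.
apply/subsetP => z /imsetP[[x y] + ->]; rewrite inE /= => xy.
by rewrite !inE /= andbT; apply/existsP; exists x; apply/existsP; exists y; rewrite xy /=.
Qed.

Lemma sum_degree_iso (G H : sgraph T) : rel_iso G H ->
  \sum_v #|nbh H v| = \sum_v #|nbh G v|.
Proof.
move=> [f fb fE]; rewrite (reindex f) /=; last exact: onW_bij.
apply: eq_bigr => v _; rewrite -(card_imset (mem (nbh G v)) (bij_inj fb)).
apply: eq_card => u; have [g fg gf] := fb; rewrite inE -(gf u) fE.
by rewrite mem_imset ?inE //; apply: bij_inj.
Qed.

End Degrees.

(** * Adjacency through positions, and ends versus groups *)

Section Model.
Variables (T : finType) (B : ububble T).
Implicit Types (u v w : T).
Let n := #|T|.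
Let crow := row_of B.
Let ccol := col_of B.

Definition plus_left v := v \in bubble_plus_any B (row_of B v) (col_of B v).
Definition plus_right v := v \in bubble_any_plus B (row_of B v) (col_of B v).

Lemma mem_own v : v \in bubble B (crow v) (ccol v).
Proof.
have [s [t [i [j h]]]] := quadrant_cover B v.
have hv : v \in bubble B i j by apply/bubbleP; exists s, t.
by rewrite /crow /ccol (row_ofE hv) (col_ofE hv).
Qed.

Lemma mem_bubble i j v : (v \in bubble B i j) = (crow v == i) && (ccol v == j).
Proof.
apply/idP/andP => [h|[/eqP<- /eqP<-]]; last exact: mem_own.
by rewrite /crow /ccol (row_ofE h) (col_ofE h) !eqxx.
Qed.

Lemma mem_plus_any i j v :
  (v \in bubble_plus_any B i j) = [&& crow v == i, ccol v == j & plus_left v].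
Proof.
apply/idP/and3P => [h|[/eqP<- /eqP<- //]].
have : v \in bubble B i j by move: h; rewrite !inE => ->.
by rewrite mem_bubble => /andP[/eqP e1 /eqP e2]; rewrite /plus_left -/crow -/ccol e1 e2 !eqxx.
Qed.

Lemma mem_any_plus i j v :
  (v \in bubble_any_plus B i j) = [&& crow v == i, ccol v == j & plus_right v].
Proof.
apply/idP/and3P => [h|[/eqP<- /eqP<- //]].
have : v \in bubble B i j by move: h; rewrite !inE => /orP[]->; rewrite ?orbT.
by rewrite mem_bubble => /andP[/eqP e1 /eqP e2]; rewrite /plus_right -/crow -/ccol e1 e2 !eqxx.
Qed.

Lemma mem_column j v : (v \in column B j) = (ccol v == j).
Proof.
apply/in_column/eqP => [[i]|<-]; last by exists (crow v); apply: mem_own.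
by rewrite mem_bubble => /andP[_ /eqP].
Qed.

Lemma own_range v : (1 <= ccol v <= ncol B) && (1 <= crow v <= nrow B (ccol v)).
Proof. exact: bubble_range (mem_own v). Qed.

(* Doubling the rows turns conditions (b) and (c) into one comparison [cell v < stretch u]. *)
Definition cell v := crow v + crow v + (1 - plus_left v).
Definition stretch v := crow v + crow v + plus_right v.

Definition arcb u v :=
  (ccol u == ccol v) || (((ccol u).+1 == ccol v) && (cell v < stretch u)).

Lemma arcP u v : bubble_arc B u v <-> arcb u v.
Proof.
rewrite /arcb /cell /stretch; split=> [[i [j [i' [j' []]]]]|].
  rewrite !mem_bubble => /andP[/eqP<- /eqP<-] /andP[/eqP<- /eqP<-].
  case=> [->|[-> h]|[-> h]]; rewrite ?eqxx //=.
    by apply/orP; right; lia.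
  by rewrite mem_any_plus mem_plus_any => /and3P[_ _ ->] /and3P[_ _ ->]; apply/orP; right; lia.
move=> h; exists (crow u), (ccol u), (crow v), (ccol v); split; try exact: mem_own.
move: h => /orP[/eqP->|/andP[/eqP c h]]; first by constructor 1.
case: (ltnP (crow v) (crow u)) => r; first by constructor 2.
constructor 3; rewrite mem_any_plus mem_plus_any !eqxx /=.
by move: h; case: (plus_left v); case: (plus_right u) => h; split=> //; lia.
Qed.

Lemma bubble_adjE u v : bubble_adj B u v = (u != v) && (arcb u v || arcb v u).
Proof.
congr (_ && _); apply/asboolP/orP.
  by move=> []/arcP; [left|right].
by move=> []/arcP; [left|right].
Qed.

Definition idx v := index v (enum T).
(** This and the next three functions are the first four arrays of [ububble_input], so the sorting
    lemmas apply to them directly. *)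
Definition colN := nth 0 [seq col_of B v | v <- enum T].
Definition rowN := nth 0 [seq row_of B v | v <- enum T].
Definition leftN := nth 0 [seq nat_of_bool (plus_left v) | v <- enum T].
Definition rightN := nth 0 [seq nat_of_bool (plus_right v) | v <- enum T].
Definition cellN i := rowN i + rowN i + (1 - leftN i).
Definition stretchN i := rowN i + rowN i + rightN i.

Lemma idx_lt v : idx v < n.
Proof. by rewrite /n cardE index_mem mem_enum. Qed.

Lemma idx_surj i : i < n -> exists v, idx v = i.
Proof.
move=> lin; have /card_gt0P[v0 _] : 0 < #|T| by apply: leq_ltn_trans lin.
by exists (nth v0 (enum T) i); rewrite /idx index_uniq ?enum_uniq // -cardE.
Qed.

Lemma idx_inj : injective idx.
Proof.
move=> u v e; rewrite -(nth_index u (mem_enum T u)) -(nth_index u (mem_enum T v)).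
by rewrite -/(idx u) -/(idx v) e.
Qed.

Lemma nth_idx (f : T -> nat) v : nth 0 [seq f w | w <- enum T] (idx v) = f v.
Proof. by rewrite (nth_map v) ?nth_index ?mem_enum // index_mem mem_enum. Qed.

Lemma colN_idx v : colN (idx v) = ccol v. Proof. exact: nth_idx. Qed.
Lemma cellN_idx v : cellN (idx v) = cell v.
Proof. by rewrite /cellN /rowN /leftN !nth_idx. Qed.
Lemma stretchN_idx v : stretchN (idx v) = stretch v.
Proof. by rewrite /stretchN /rowN /rightN !nth_idx. Qed.

Lemma nth_bool_le (f : T -> bool) i : nth 0 [seq nat_of_bool (f v) | v <- enum T] i <= 1.
Proof.
case: (ltnP i n) => hi; last by rewrite nth_default // size_map -cardE.
by have [v <-] := idx_surj hi; rewrite (nth_idx (fun v => nat_of_bool (f v))); case: (f v).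
Qed.

Definition posn v := rank n colN cellN (idx v).
Definition endn v := reach n colN cellN stretchN (idx v).

Lemma posn_surj p : p < n -> exists v, posn v = p.
Proof.
move=> pn; have [i lin <-] := rank_surj colN cellN pn.
by have [v <-] := idx_surj lin; exists v.
Qed.

Lemma posn_inj : injective posn.
Proof. by move=> u v /(rank_inj (idx_lt u) (idx_lt v)) /idx_inj. Qed.

Lemma posn_lt v : posn v < n. Proof. exact/rank_lt/idx_lt. Qed.

(** For [u] before [v], an arc between them stays in the column or runs from [u] to [v], so
    adjacency means that [u] reaches [v], that is, [v] lies below the end of [u]. Only the values of
    [E] at positions matter, since [E] will be an array of the program. *)
Lemma bubble_adj_order (E : nat -> nat) u v : (forall w, E (posn w) = endn w) ->
  bubble_adj B u v = order_adj E (posn u) (posn v).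
Proof.
move=> hE; have fwd x y : posn x < posn y -> bubble_adj B x y = (posn y < endn x).
  rewrite (rank_precedes _ _ (idx_lt x) (idx_lt y)) (reachedE _ _ _ _ (idx_lt y)).
  rewrite bubble_adjE /arcb /precedes /before /reached !colN_idx !cellN_idx stretchN_idx => h.
  have -> : x != y by apply: contraTneq h => ->; lia.
  by move: h; lia.
rewrite /order_adj !hE; case: (ltngtP (posn u) (posn v)) => [/fwd//|/fwd<- /=|/posn_inj->].
  by rewrite bubble_adj_sym.
by rewrite bubble_adj_irr.
Qed.

Lemma same_group_refl u : same_group B u u.
Proof.
have /andP[/andP[_ cn] _] := own_range u.
by apply/existsP; exists (Ordinal (cn : ccol u < (ncol B).+1)); rewrite !mem_column !eqxx.
Qed.

(** An end depends only on the column and on the neighbours in the next column, which is what a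
    group fixes. Distinct ends therefore force distinct groups. *)
Lemma same_group_end u v : same_group B u v -> endn u = endn v.
Proof.
move=> /existsP[j]; rewrite !mem_column => /and3P[/eqP cu /eqP cv /eqP/setP e].
apply: eq_in_count => i; rewrite mem_iota add0n /= => /idx_surj[y <-].
rewrite /reached !colN_idx cellN_idx !stretchN_idx cu cv.
have := e y; rewrite !inE mem_column /= !bubble_adjE /arcb cu cv.
case: (eqVneq (ccol y) j.+1) => [cy|_]; last by rewrite !andbF.
have -> : u != y by apply/eqP => uy; move: cu; rewrite uy cy; lia.
have -> : v != y by apply/eqP => vy; move: cv; rewrite vy cy; lia.
by rewrite cy; lia.
Qed.

Lemma size_le_num_groups (h : T -> nat) (S : {set T}) (l : seq nat) :
  (forall u v, same_group B u v -> h u = h v) -> uniq l ->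
  (forall q, q \in l -> exists2 u, u \in S & h u = q) -> size l <= num_groups B S.
Proof.
move=> hG ul hl.
(* On a group, [hg] reads the common value of [h] from an arbitrary member; the default 0 never
   arises, since a group contains its own vertex. *)
pose hg (g : {set T}) := if [pick u in g] is Some u then h u else 0.
rewrite /num_groups cardE -(size_map hg); apply: uniq_leq_size => // q /hl[u uS <-].
apply/mapP; exists (group_of B u); first by rewrite mem_enum imset_f.
rewrite /hg; case: pickP => [w|/(_ u)]; first by rewrite inE => /hG.
by rewrite inE same_group_refl.
Qed.

Lemma mem_bubbles a b i j u : u \in bubble B i j -> a <= i < b ->
  u \in \bigcup_(a <= k < b) bubble B k j.
Proof. by move=> ui ab; rewrite (big_rem i) ?mem_index_iota //= inE ui. Qed.

(** The two alternatives in the group number match the two kinds of [v]. For [v] in [B^{+*}], the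
    earlier neighbours may include [B^{*+}] of the same row in the previous column, but within the
    own bubble only [B^{+*}] comes earlier. Otherwise the previous column contributes only greater
    rows, while any part of the own bubble may come earlier. *)
Lemma live_le_group_number (E : nat -> nat) v : (forall w, E (posn w) = endn w) ->
  size (live E (posn v)) <= group_number B v.
Proof.
move=> hE; rewrite /group_number -/crow -/ccol leq_max.
set D := (X in X :|: _); apply/orP.
have key u : posn u < posn v -> posn v < endn u ->
    u \in nbh (bubble_graph B) v :&: (D :|:
      (if plus_left v then
         bubble_any_plus B (crow v) (ccol v).-1 :|: bubble_plus_any B (crow v) (ccol v)
       else bubble B (crow v) (ccol v))).
  move=> uv vu; rewrite in_setI; apply/andP; split.
    by rewrite inE /= bubble_adj_sym (bubble_adj_order u v hE) /order_adj uv hE vu.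
  move: uv vu; rewrite (rank_precedes _ _ (idx_lt u) (idx_lt v)) (reachedE _ _ _ _ (idx_lt v)).
  rewrite /precedes /before /reached !colN_idx !cellN_idx stretchN_idx => uv vu.
  have /andP[/andP[cu1 cun] /andP[ru1 run]] := own_range u.
  have ow := mem_own u.
  case: (ltngtP (ccol u) (ccol v)) uv vu => //= [c _|c uv _].
    move=> /andP[/eqP cv h].
    move: h; rewrite /cell /stretch.
    have cu : (ccol v).-1 = ccol u by rewrite cv.
    case: (ltngtP (crow v) (crow u)) => r h.
    - rewrite inE /D inE cu (mem_bubbles ow) ?orTb //; lia.
    - by move: h; case: (plus_left v); case: (plus_right u) => h; lia.
    have -> : plus_left v by move: h; case: (plus_left v) => // h; case: (plus_right u) h; lia.
    have pr : plus_right u by move: h; case: (plus_right u) => //; lia.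
    by rewrite in_setU [X in _ || X]in_setU mem_any_plus cu r !eqxx pr /= orbT.
  move: uv; rewrite /cell => uv.
  case: (ltngtP (crow u) (crow v)) => r.
  - by rewrite inE /D [X in X || _]inE -c (mem_bubbles ow) ?orbT // ru1.
  - by move: uv; case: (plus_left v); case: (plus_left u) => /=; lia.
  case pv: (plus_left v) uv => uv; last by rewrite inE -r -c ow orbT.
  have pu : plus_left u by move: uv; case: (plus_left u) => //=; lia.
  by rewrite in_setU [X in _ || X]in_setU mem_plus_any r c !eqxx pu !orbT.
have sz (S : {set T}) : (forall u, posn u < posn v -> posn v < endn u -> u \in S) ->
    size (live E (posn v)) <= num_groups B S.
  move=> hS; apply: (@size_le_num_groups endn); [exact: same_group_end|exact: undup_uniq|].
  move=> q; rewrite mem_undup => /mapP[x]; rewrite mem_filter mem_iota /= => /andP[h1 h2] ->.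
  have [u eu] := posn_surj (ltn_trans h2 (posn_lt v)).
  by exists u; rewrite -?hE ?eu //; apply: hS; rewrite -?hE eu.
by move: key; case: (plus_left v) => key; [left|right]; apply: sz.
Qed.

Lemma phi_le : phi B <= n.
Proof.
apply/bigmax_leqP => v _; rewrite /group_number geq_max.
by rewrite !(leq_trans (leq_imset_card _ _)) ?max_card.
Qed.

Lemma sum_by_column (f : nat -> nat) (nc : nat) :
  (forall i, i < n -> 1 <= colN i <= nc) ->
  \sum_(i <- iota 0 n) f (colN i) = \sum_(1 <= c < nc.+1) col_size n colN c * f c.
Proof.
move=> hc; rewrite (eq_big_seq (fun i => \sum_(1 <= c < nc.+1) (colN i == c) * f c)).
  rewrite exchange_big /=; apply: eq_bigr => c _.
  rewrite -big_distrl /=; congr (_ * _).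
  by rewrite /col_size -sum1_count [RHS]big_mkcond; apply: eq_bigr => i _; case: eqP.
move=> i; rewrite mem_iota add0n /= => /hc /andP[c1 cn].
rewrite (bigD1_seq (colN i)) ?iota_uniq ?mem_index_iota ?c1 ?ltnS //= eqxx mul1n.
by rewrite big1 ?addn0 // => c /negbTE; rewrite eq_sym => ->.
Qed.

(** A column is a clique: without [v] it lies in the neighbourhood of [v], so its size is at most
    one more than the degree of [v]. *)
Lemma sum_sq_columns (G : sgraph T) : rel_iso G (bubble_graph B) ->
  \sum_(i <- iota 0 n) col_size n colN (colN i) <= n + 2 * #|edges G|.
Proof.
move=> iso; have eT : iota 0 n = [seq idx v | v <- enum T].
  apply: (@eq_from_nth _ 0); first by rewrite size_iota size_map -cardE.
  move=> i; rewrite size_iota => lin; have [v <-] := idx_surj lin.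
  by rewrite nth_iota ?idx_lt // (nth_map v) ?index_mem ?mem_enum // nth_index ?mem_enum.
have cs v : col_size n colN (colN (idx v)) = #|[set u | ccol u == ccol v]|.
  rewrite /col_size eT count_map enumT cardE /enum_mem size_filter.
  apply: eq_count => u /=; rewrite !colN_idx.
  by rewrite [RHS]inE.
rewrite eT big_map big_enum /=.
apply: leq_trans (_ : \sum_(v : T) (1 + #|nbh (bubble_graph B) v|) <= _).
  apply: leq_sum => v _; rewrite cs (cardsD1 v) inE eqxx leq_add2l.
  apply: subset_leq_card; apply/subsetP => u; rewrite !inE /= bubble_adjE /arcb.
  by rewrite eq_sym => /andP[-> /eqP->]; rewrite eqxx.
rewrite big_split /= sum1_card leq_add2l (sum_degree_iso iso); exact: sum_degree_le.
Qed.

End Model.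

(** Each product is at most the sum of the two squares; shifting the index in the second sum costs
    nothing because [a m.+1] is 0. *)
Lemma adjacent_products_le (a : nat -> nat) m : a m.+1 = 0 ->
  \sum_(1 <= c < m.+1) a c * a c.+1 <= 2 * \sum_(1 <= c < m.+1) a c * a c.
Proof.
move=> am; rewrite mul2n -addnn.
apply: leq_trans (_ : \sum_(1 <= c < m.+1) (a c * a c + a c.+1 * a c.+1) <= _).
  by apply: leq_sum => c _; nia.
rewrite big_split leq_add2l /= -(big_add1 _ _ 1 m.+2 xpredT (fun c => a c * a c)).
case: m am => [|m] am; first by rewrite !big_geq.
by rewrite [X in X <= _]big_nat_recr //= am addn0 [X in _ <= X]big_ltn // leq_addl.
Qed.

Lemma far_leq E p b : (forall x, x < p -> E x <= b) -> far E p <= b.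
Proof.
elim: p => [|p IH] h; first by rewrite /far big_nil.
by rewrite farS geq_max h // IH // => x xp; apply: h; apply: ltnW.
Qed.

(** * The complete program *)

Definition bubble_program : rcmd := (prepare ;; place ;; build)%RC.

Lemma bubble_program_correct (T : finType) (G : sgraph T) (B : ububble T) :
  ububble_model B G ->
  exists (t : nat) (s : rstate) (e : cwexpr),
    [/\ exec (1100 * (#|T| + #|edges G|)) bubble_program (ububble_input B) t s,
        t <= 1100 * (#|T| + #|edges G|), output s = cw_encode e,
        k_expression (phi B + 2) e & defines e G].
Proof.
move=> [iso hcol hrow _ _ _].
set n := #|T|; set m := #|edges G|; set W := 1100 * (n + m).
have n0 : 0 < n by apply: ububble_nonempty B.
have W_ge : 2 * n + 10 <= W by rewrite /W; lia.
pose nc := ncol B.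
(* Every column and every row contains a vertex, so their numbers are at most [n]; this keeps the
   words linear in [n]. *)
have range_le (f : T -> nat) k :
    (forall i, 1 <= i <= k -> exists v, f v = i) -> k <= n.
  move=> h; rewrite -(size_iota 1 k) /n cardE -(size_map f).
  apply: uniq_leq_size (iota_uniq _ _) _ => i; rewrite mem_iota add1n ltnS => /h[v <-].
  by rewrite map_f ?mem_enum.
have nc_le : nc <= n.
  apply: (range_le (col_of B)) => j hj; have [i _ /set0Pn[v hv]] := hcol j hj.
  by exists v; apply: col_ofE hv.
have row_le i : i < n -> rowN B i <= n.
  move=> /idx_surj[v <-]; rewrite /rowN (nth_idx (row_of B)).
  have /andP[c1 /andP[r1 r2]] := own_range B v.
  apply: (range_le (row_of B)) => k /andP[k1 kr].
  have [|j' _ /set0Pn[w hw]] := hrow k _ c1; first by rewrite k1 (leq_trans kr r2).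
  by exists w; apply: row_ofE hw.
have col_range i : i < n -> 1 <= colN B i <= nc.
  by move=> /idx_surj[v <-]; rewrite colN_idx; have /andP[] := own_range B v.
pose csz := col_size n (colN B).
have csz0 : csz nc.+1 = 0.
  rewrite /csz /col_size -[RHS](count_pred0 (iota 0 n)); apply: eq_in_count => i.
  by rewrite mem_iota add0n /= => /col_range h; lia.
pose S2 := \sum_(1 <= c < nc.+1) csz c * csz c.
pose S12 := \sum_(1 <= c < nc.+1) csz c * csz c.+1.
have S1n : \sum_(1 <= c < nc.+1) csz c = n.
  have := sum_by_column (fun _ => 1) col_range; rewrite sum_seq_const size_iota muln1 => h.
  by apply: etrans (esym h); apply: eq_bigr => c _; rewrite muln1.
have S2_le : S2 <= n + 2 * m.
  by rewrite /S2 -(sum_by_column csz col_range); apply: sum_sq_columns.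
have S12_le : S12 <= 2 * S2 by apply: adjacent_products_le.
pose s0 := ububble_input B.
have tab0 : tables n nc (colN B) (rowN B) (leftN B) (rightN B) 0 s0.
  by split=> //= c; rewrite nth_nil.
have bl0 : blank s0 by split=> //= q; rewrite nth_nil.
suff [t [s [ex [e [E [lb [ht hE [wf la ca [f [fi fa _]]] ho]]]]]]] :
    wp W bubble_program s0 (fun t s => exists e E lb,
      [/\ t <= W, forall w, E (posn B w) = endn B w,
          built (phi B).+1 n (order_adj E) lb e & output s = cw_encode e]).
  exists t, s, e; split=> //.
    (* The labels lie between 0 and [phi B + 1], a range of [phi B + 2] values. *)
    split=> //; rewrite addn2 -(size_iota 0 (phi B).+2).
    apply: uniq_leq_size; first exact: undup_uniq.
    by move=> l; rewrite mem_undup mem_iota add0n ltnS => /(allP la).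
  (* A vertex of [G] goes to its image in the bubble graph, then to the position of that image, then
     to the vertex of [e] at that position. *)
  have [g gb gE] := iso; exists (fun x => f (posn B (g x))).
    apply: inj_card_bij; last by rewrite ca.
    by move=> x y /fi-/(_ (posn_lt _ _) (posn_lt _ _))/posn_inj/(bij_inj gb).
  by move=> x y; rewrite fa ?posn_lt // -bubble_adj_order // -gE.
rewrite /bubble_program; wp_step.
apply: wp_conseq.
  apply: (wp_prepare (n := n) (nc := nc) (col := colN B) (row := rowN B)
    (sp := leftN B) (tp := rightN B)) => // i; exact: nth_bool_le.
move=> t1 s1 [ht1 tab1 bl1]; wp_step.
apply: wp_conseq.
  apply: (wp_place (n := n) (nc := nc) (col := colN B) (row := rowN B)
    (sp := leftN B) (tp := rightN B)) => // i; exact: nth_bool_le.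
move=> t2 s2 [ht2 r2 bl2 pl2].
pose E := arrs s2 9.
have hE w : E (posn B w) = endn B w by apply: pl2; rewrite ?idx_lt.
apply: wp_conseq.
  (* The largest label is [phi B + 1]: at most [phi B] live labels and one for the new vertex,
     besides the dead label 0. *)
  apply: (@wp_build W n (phi B).+1 E) => //.
  - move=> x /(posn_surj B)[v <-]; rewrite hE reach_le andbT.
    exact/rank_lt_reach/idx_lt.
  - by rewrite ltnS phi_le.
  - move=> p /(posn_surj B)[v <-]; rewrite ltnS.
    apply: leq_trans (live_le_group_number v hE) _.
    by rewrite /phi (bigD1 v) //= leq_maxl.
move=> t3 s3 [ht3 [e hb ho]].
exists e, E; eexists; split; [|exact: hE|exact: hb|exact: ho].
have far_sum : \sum_(0 <= p < n) (far E p - p) <= S2 + S12.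
  have -> : S2 + S12 = \sum_(i <- iota 0 n) (csz (colN B i) + csz (colN B i).+1).
    rewrite (sum_by_column (fun c => csz c + csz c.+1) col_range) -big_split /=.
    by apply: eq_bigr => c _; rewrite mulnDr.
  (* The sum over positions becomes a sum over vertices, where [reach_near] bounds each scan by two
     column sizes. *)
  rewrite /index_iota subn0 -(perm_big _ (perm_rank n (colN B) (cellN B))) big_map /=.
  rewrite big_seq [X in _ <= X]big_seq; apply: leq_sum => i; rewrite mem_iota add0n /= => lin.
  rewrite leq_subLR addnA; apply: far_leq => x xi.
  have xn : x < n by apply: ltn_trans xi _; apply: rank_lt.
  have [u eu] := posn_surj B xn; rewrite -eu hE; apply: reach_near.
  by rewrite -(rank_precedes _ _ (idx_lt u) lin) -/(posn B u) eu.
have h2 : t2 <= 60 * S2 + 60 * S12 + 210 * n + 110 * n + 20.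
  apply: leq_trans ht2 _; rewrite leq_add2r big_split /= sum_nat_const_nat.
  apply: leq_add; last by lia.
  rewrite -[X in 210 * X]S1n !big_distrr -!big_split /=; apply: leq_sum => c _.
  by rewrite -/csz; nia.
have h3 : t3 <= 50 * (S2 + S12) + 210 * n + 20.
  apply: leq_trans ht3 _; rewrite leq_add2r big_split /= sum_nat_const_nat -big_distrr /=.
  by apply: leq_add; lia.
(* As [S2 + S12] is at most [3 * n + 6 * m], the three phases take at most [920 * n + 660 * m + 100]
   steps, and [n] is positive. *)
rewrite /W; lia.
Qed.

Theorem theorem28 (R : realType) :
  (forall (T : finType) (G : sgraph T) (B : ububble T),
     mixed_unit_interval R G -> ububble_model B G ->
     exists2 c : nat, is_cwd G c & c <= phi B + 2) /\
  (exists (p : rcmd) (C : nat),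
     forall (T : finType) (G : sgraph T) (B : ububble T),
       mixed_unit_interval R G -> ububble_model B G ->
       exists (t : nat) (s : rstate) (e : cwexpr),
         [/\ exec (C * (#|T| + #|edges G|)) p (ububble_input B) t s,
             t <= C * (#|T| + #|edges G|),
             output s = cw_encode e,
             k_expression (phi B + 2) e
           & defines e G]).
Proof.
split=> [T G B _ hB|]; last first.
  by exists bubble_program, 1100 => T G B _; apply: bubble_program_correct.
have [t [s [e [_ _ _ ke de]]]] := bubble_program_correct hB.
(* Reflecting constructibility into a boolean lets the least [k] be chosen. *)
have ex : exists k, `[< constructible G k >].
  by exists (phi B + 2); apply/asboolP; exists e.
case: (ex_minnP ex) => c /asboolP hc cmin; exists c; last first.
  by apply: cmin; apply/asboolP; exists e.
by split=> // k hk; apply: cmin; apply/asboolP.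
Qed.
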